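(* The following identities hold, for $n\ge2$, $n\ge3$, $n\ge2$ and $n\ge4$ in the cases $\tilde{A}_n$, $\tilde{B}_n$, $\tilde{C}_n$ and $\tilde{D}_n$, respectively: \begin{align*} \hat{\chi}_{\tilde{A}_n}(q)&=\hat{\chi}_{A_n}(q)+\sum^n_{k=1} k(-1)^kq^{\binom{k+1}{2}}\hat{\chi}_{A_{n-k-1}}(q),\\ \hat{\chi}_{\tilde{B}_n}(q)&=\hat{\chi}_{B_n}(q)+\sum_{k=0}^{n}(-1)^{k}q^{k(k-1)}\hat{\chi}_{B_{n-k}}(q),\\ \hat{\chi}_{\tilde{C}_n}(q)&=\sum_{k=0}^{n}(-1)^kq^{k^2}\hat{\chi}_{B_{n-k}}(q),\\ \hat{\chi}_{\tilde{D}_n}(q)&=\hat{\chi}_{D_n}(q)+(-1)^nq^{n(n-1)}+\sum_{k=0}^{n}(-1)^kq^{k(k-1)}\hat{\chi}_{D_{n-k}}(q), \end{align*} where $\hat{\chi}_{A_i}(q)=\hat{\chi}_{B_i}(q)=1$ for $i\le 0$ and $\hat{\chi}_{D_i}(q)=1$ for $i\le 1$ by definition.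
   Context: For a Coxeter group $W$ with finite set $S$ of Coxeter generators, $\ell(w)$ is the minimal number of generators in an expression of $w$. $W$ is ordered by the (left) weak order: $u\le w$ if $w=s_k\cdots s_1u$ for some $s_j\in S$ with $\ell(s_j\cdots s_1u)=\ell(u)+j$ for $0\le j\le k$. The bottom element is the identity $e$ and the rank of $w$ is $\ell(w)$. Let $\mu_W$ be the Möbius function of this poset, defined by $\sum_{x\le t\le y}\mu_W(x,t)=\delta_{x,y}$ for all $x\le y$. The modified characteristic polynomial is \[\hat\chi_W(q)=\sum_{w\in W}\mu_W(e,w)\,q^{\ell(w)}\] (also for infinite $W$; only finitely many $w$ have $\mu_W(e,w)\neq0$). Coxeter graphs (edges unlabeled, i.e. $m=3$, unless stated). $A_n$: a path on $n$ vertices. $B_n$: a path on $n$ vertices with one end edge labeled $4$. $D_n$: a path on vertices $1,\dots,n-1$ with an additional vertex $n$ adjacent only to $n-2$. Conventions: $B_1\cong A_1$, $D_2\cong A_1\times A_1$, $D_3\cong A_3$. The affine groups have $n+1$ generators. $\tilde A_n$ ($n\ge2$): a cycle on $n+1$ vertices. For the others the generators are $s_0,\dots,s_n$. $\tilde B_n$ ($n\ge3$): a path $s_1,s_2,\dots,s_n$ with the edge $s_{n-1}s_n$ labeled $4$, and $s_0$ adjacent only to $s_2$. $\tilde C_n$ ($n\ge2$): a path $s_0,s_1,\dots,s_n$ with the edges $s_0s_1$ and $s_{n-1}s_n$ labeled $4$. $\tilde D_n$ ($n\ge4$): a path $s_1,s_2,\dots,s_{n-1}$, with $s_0$ adjacent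 only to $s_2$ and $s_n$ adjacent only to $s_{n-2}$. *)

(* Defs.v *)
From HB Require Import structures.
From mathcomp Require Import all_boot all_order all_algebra.
From mathcomp Require Import generic_quotient boolp classical_sets cardinality fsbigop.

Set Implicit Arguments.
Unset Strict Implicit.
Unset Printing Implicit Defensive.

Import GRing.Theory.
Local Open Scope group_scope.
Local Open Scope quotient_scope.

(* As usual, the label 0 encodes m(s, t) = oo. *)
Record coxeter_matrix (S : finType) := CoxeterMatrix {
  cox_label :> S -> S -> nat;
  cox_diag : forall s, cox_label s s = 1%N;
  cox_sym : forall s t, cox_label s t = cox_label t s;
  cox_offdiag : forall s t, s != t -> cox_label s t != 1%N }.

(* The group < S | (s t)^m(s, t) = 1 for all s, t >.  Since m(s, s) = 1, every
   generator is an involution, so words in S without formal inverses suffice;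
   for m(s, t) = 0 the relator is the empty word, i.e. there is no relation. *)
Section CoxeterGroup.
Variables (S : finType) (M : coxeter_matrix S).

Inductive cox_rel : seq S -> seq S -> Prop :=
| CoxRelator s t : cox_rel (flatten (nseq (M s t) [:: s; t])) [::]
| CoxRefl u : cox_rel u u
| CoxSym u v : cox_rel u v -> cox_rel v u
| CoxTrans u v w : cox_rel u v -> cox_rel v w -> cox_rel u w
| CoxCat u u' v v' :
    cox_rel u u' -> cox_rel v v' -> cox_rel (u ++ v) (u' ++ v').

Definition cox_relb (u v : seq S) : bool := `[< cox_rel u v >].

Lemma cox_relb_refl : reflexive cox_relb.
Proof. by move=> u; apply/asboolP; exact: CoxRefl. Qed.

Lemma cox_relb_sym : symmetric cox_relb.
Proof. by move=> u v; apply/asboolP/asboolP; exact: CoxSym. Qed.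

Lemma cox_relb_trans : transitive cox_relb.
Proof.
by move=> v u w /asboolP uv /asboolP vw; apply/asboolP; exact: CoxTrans vw.
Qed.

Canonical cox_equiv := EquivRel cox_relb cox_relb_refl cox_relb_sym cox_relb_trans.

Definition cox_group := {eq_quot cox_equiv}.

HB.instance Definition _ := EqQuotient.on cox_group.
HB.instance Definition _ := Choice.on cox_group.

Definition cox_class (u : seq S) : cox_group := \pi_cox_group u.

Lemma cox_classP u v : cox_class u = cox_class v <-> cox_rel u v.
Proof. by split=> [/eqmodP/asboolP|?] //; apply/eqmodP/asboolP. Qed.

Lemma cox_class_repr (x : cox_group) : cox_class (repr x) = x.
Proof. exact: reprK. Qed.

Lemma cox_rel_square s : cox_rel [:: s; s] [::].
Proof. by have := CoxRelator s s; rewrite cox_diag. Qed.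

Lemma cox_rel_rev u v : cox_rel u v -> cox_rel (rev u) (rev v).
Proof.
elim=> {u v} [s t|u|u v _ IH|u v w _ IH1 _ IH2|u u' v v' _ IH1 _ IH2].
- rewrite [rev [::]]/=; suff -> : rev (flatten (nseq (M s t) [:: s; t])) =
      flatten (nseq (M t s) [:: t; s]) by exact: CoxRelator.
  rewrite cox_sym; elim: (M t s) => // n IHn.
  by rewrite -[in LHS]addn1 nseqD flatten_cat rev_cat IHn.
- exact: CoxRefl.
- exact: CoxSym.
- exact: CoxTrans IH2.
- by rewrite !rev_cat; exact: CoxCat.
Qed.

Lemma cox_rel_revV u : cox_rel (rev u ++ u) [::].
Proof.
elim: u => [|s u IHu]; first exact: CoxRefl.
rewrite rev_cons -cats1 -catA /= -[rev u ++ _]/(rev u ++ ([:: s; s] ++ u)).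
apply: CoxTrans IHu; apply: CoxCat; first exact: CoxRefl.
by rewrite -[X in cox_rel _ X]cat0s; apply: CoxCat (cox_rel_square s) (CoxRefl _).
Qed.

Definition cox_one : cox_group := cox_class [::].
Definition cox_mul (x y : cox_group) := cox_class (repr x ++ repr y).
Definition cox_inv (x : cox_group) := cox_class (rev (repr x)).

Lemma cox_mulE u v : cox_mul (cox_class u) (cox_class v) = cox_class (u ++ v).
Proof.
by apply/cox_classP; apply: CoxCat; apply/cox_classP; rewrite cox_class_repr.
Qed.

Lemma cox_invE u : cox_inv (cox_class u) = cox_class (rev u).
Proof.
by apply/cox_classP/cox_rel_rev/cox_classP; rewrite cox_class_repr.
Qed.

Lemma cox_mulA : associative cox_mul.
Proof.
move=> x y z; rewrite -(cox_class_repr x) -(cox_class_repr y).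
by rewrite -(cox_class_repr z) !cox_mulE catA.
Qed.

Lemma cox_mul1 : left_id cox_one cox_mul.
Proof. by move=> x; rewrite -(cox_class_repr x) cox_mulE. Qed.

Lemma cox_mulr1 : right_id cox_one cox_mul.
Proof. by move=> x; rewrite -(cox_class_repr x) cox_mulE cats0. Qed.

Lemma cox_mulV : left_inverse cox_one cox_inv cox_mul.
Proof.
move=> x; rewrite -(cox_class_repr x) cox_invE cox_mulE.
by apply/cox_classP; exact: cox_rel_revV.
Qed.

Lemma cox_mulrV : right_inverse cox_one cox_inv cox_mul.
Proof.
move=> x; rewrite -(cox_class_repr x) cox_invE cox_mulE.
by apply/cox_classP; rewrite -{1}[repr x]revK; exact: cox_rel_revV.
Qed.

HB.instance Definition _ := isGroup.Build cox_group
  cox_mulA cox_mul1 cox_mulr1 cox_mulV cox_mulrV.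

Definition cox_gen (s : S) : cox_group := cox_class [:: s].

Lemma cox_class_prod u : cox_class u = \prod_(s <- u) cox_gen s.
Proof.
elim: u => [|s u IHu]; first by rewrite big_nil.
by rewrite big_cons -IHu; exact/esym/cox_mulE.
Qed.

Lemma cox_word_exists (w : cox_group) :
  exists k, [exists u : k.-tuple S, w == \prod_(s <- u) cox_gen s].
Proof.
exists (size (repr w)); apply/existsP; exists (in_tuple (repr w)).
by rewrite -cox_class_prod cox_class_repr.
Qed.

Definition cox_len (w : cox_group) : nat := ex_minn (cox_word_exists w).

(* left_mul [:: s_1; ...; s_k] u = s_k * ... * s_1 * u *)
Definition left_mul (r : seq S) (u : cox_group) : cox_group :=
  foldl (fun v s => cox_gen s * v) u r.

Definition weak_le (u w : cox_group) : Prop :=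
  exists2 r : seq S, w = left_mul r u &
    forall j, (j <= size r)%N ->
      cox_len (left_mul (take j r) u) = (cox_len u + j)%N.

End CoxeterGroup.

Local Open Scope classical_set_scope.
Local Open Scope ring_scope.

(* The defining equation determines mu x y for x <= y when intervals are
   finite; setting mu x y = 0 at all other pairs makes mu unique. *)
Definition is_moebius (T : choiceType) (le : T -> T -> Prop)
    (mu : T -> T -> int) : Prop :=
  (forall x y, le x y ->
     \sum_(t \in [set t | le x t /\ le t y]) mu x t = (x == y)%:R) /\
  (forall x y, ~ le x y -> mu x y = 0).

Definition moebius (T : choiceType) (le : T -> T -> Prop) : T -> T -> int :=
  xget (fun _ _ => 0) [set mu | is_moebius le mu].

(* Intervals of the weak order are finite, so that its Moebius function exists and
   moebius does not return the default value of xget. *)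
Section MoebiusExists.
Variables (S : finType) (M : coxeter_matrix S).
Local Notation W := (cox_group M).
Local Notation le := (@weak_le S M).

Lemma weak_le_refl (u : W) : le u u.
Proof. by exists [::] => // -[|//] _; rewrite addn0. Qed.

Lemma weak_le_len (u w : W) : le u w -> (cox_len u <= cox_len w)%N.
Proof.
by case=> r -> /(_ _ (leqnn _)); rewrite take_size => ->; exact: leq_addr.
Qed.

Lemma weak_le_ltn (u w : W) : le u w -> u <> w -> (cox_len u < cox_len w)%N.
Proof.
case=> r -> /(_ _ (leqnn _)); rewrite take_size => -> ne.
by case: r ne => //= s r _; rewrite -addSnnS leq_addr.
Qed.

Lemma finite_cox_len n : finite_set [set t : W | (cox_len t <= n)%N].
Proof.
pose f (p : {k : 'I_n.+1 & k.-tuple S}) : W :=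
  (\prod_(s <- tagged p) cox_gen M s)%g.
have : finite_set (f @` setT) by apply: finite_image; exact: finite_finset.
apply: sub_finite_set => t /=.
rewrite /cox_len; case: ex_minnP => k /existsP[u /eqP tE] _ kn.
by exists (@Tagged _ (Ordinal (kn : (k < n.+1)%N))
                   (fun k : 'I_n.+1 => k.-tuple S) u).
Qed.

Fixpoint moebius_rec k (x y : W) : int :=
  if k is k'.+1 then
    if `[< le x y >] then
      (x == y)%:R -
      \sum_(t \in [set t | (le x t /\ le t y) /\ t <> y]) moebius_rec k' x t
    else 0
  else 0.

Lemma moebius_recE k k' x y : (cox_len y < k)%N -> (cox_len y < k')%N ->
  moebius_rec k x y = moebius_rec k' x y.
Proof.
elim: k k' y => [//|k IH] [//|k'] y; rewrite !ltnS => h h' /=.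
case: ifP => // _; congr (_ - _).
apply: eq_fsbigr => t; rewrite inE => -[[xt ty] ne].
have l := weak_le_ltn ty ne.
by apply: IH; apply: leq_trans l _.
Qed.

Lemma moebiusP : is_moebius le (moebius le).
Proof.
apply: (@xgetPex _ _ [set mu | is_moebius le mu]).
exists (fun x y => moebius_rec (cox_len y).+1 x y).
split=> x y xy; last by rewrite /= asboolF.
have fin : finite_set [set t | le x t /\ le t y].
  by apply: sub_finite_set (finite_cox_len (cox_len y)) => t [_]; exact: weak_le_len.
rewrite (fsbigD1 y) //=; last by split=> //; exact: weak_le_refl.
rewrite asboolT // [X in _ + X = _](_ : _ = \sum_(t \in
  [set t | (le x t /\ le t y) /\ t <> y]) moebius_rec (cox_len y) x t) ?subrK //.
apply: eq_fsbigr => t; rewrite inE => -[[xt ty] ne].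
by apply: (@moebius_recE (cox_len t).+1) => //; exact: weak_le_ltn.
Qed.

End MoebiusExists.

(* For infinite W this is a finitely supported sum. *)
Definition chihat (S : finType) (M : coxeter_matrix S) : {poly int} :=
  \sum_(w \in [set: cox_group M])
    ((moebius (@weak_le S M) 1%g w)%:P * 'X^(cox_len w)).

(* The Coxeter matrix on {0, ..., n-1} with label 4 on the edges given by e4, label
   3 on the remaining edges given by e3, and label 2 elsewhere; edges are undirected
   but need only be given in one direction. *)
Section MatrixOfGraph.
Variables (n : nat) (e3 e4 : rel nat).

Definition graph_label (i j : 'I_n) : nat :=
  if i == j then 1
  else if e4 i j || e4 j i then 4
  else if e3 i j || e3 j i then 3
  else 2.

Lemma graph_label_diag i : graph_label i i = 1%N.
Proof. by rewrite /graph_label eqxx. Qed.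

Lemma graph_label_sym i j : graph_label i j = graph_label j i.
Proof. by rewrite /graph_label eq_sym orbC [e3 i j || _]orbC. Qed.

Lemma graph_label_offdiag i j : i != j -> graph_label i j != 1%N.
Proof. by rewrite /graph_label => /negPf->; case: ifP => // _; case: ifP. Qed.

Definition graph_matrix : coxeter_matrix 'I_n :=
  CoxeterMatrix graph_label_diag graph_label_sym graph_label_offdiag.

End MatrixOfGraph.

Definition no_edge : rel nat := fun _ _ => false.

(* In the finite types, i : 'I_n stands for the (i+1)-st vertex. *)

Definition coxA (n : nat) : coxeter_matrix 'I_n :=
  graph_matrix n (fun i j => j == i.+1) no_edge.

Definition coxB (n : nat) : coxeter_matrix 'I_n :=
  graph_matrix n (fun i j => j == i.+1)
    (fun i j => (j == i.+1) && (j.+1 == n)).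

Definition coxD (n : nat) : coxeter_matrix 'I_n :=
  graph_matrix n
    (fun i j => (j == i.+1) && (j.+1 < n)%N || (i.+3 == n) && (j.+1 == n))
    no_edge.

(* In the affine types, i : 'I_n.+1 stands for s_i. *)

Definition cox_affA (n : nat) : coxeter_matrix 'I_n.+1 :=
  graph_matrix n.+1 (fun i j => (j == i.+1) || (i == 0%N) && (j == n)) no_edge.

Definition cox_affB (n : nat) : coxeter_matrix 'I_n.+1 :=
  graph_matrix n.+1
    (fun i j => (0 < i)%N && (j == i.+1) || (i == 0%N) && (j == 2%N))
    (fun i j => (i.+1 == n) && (j == n)).

Definition cox_affC (n : nat) : coxeter_matrix 'I_n.+1 :=
  graph_matrix n.+1 (fun i j => j == i.+1)
    (fun i j => (j == i.+1) && ((i == 0%N) || (j == n))).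

Definition cox_affD (n : nat) : coxeter_matrix 'I_n.+1 :=
  graph_matrix n.+1
    (fun i j => [|| [&& (0 < i)%N, j == i.+1 & (j < n)%N],
                    (i == 0%N) && (j == 2%N) | (i.+2 == n) && (j == n)])
    no_edge.

(* Indices are integers because A_{n-k-1} occurs with n - k - 1 = -1. *)

Definition chihatA (i : int) : {poly int} :=
  if i <= 0 then 1 else chihat (coxA `|i|).

Definition chihatB (i : int) : {poly int} :=
  if i <= 0 then 1 else chihat (coxB `|i|).

Definition chihatD (i : int) : {poly int} :=
  if i <= 1 then 1 else chihat (coxD `|i|).

(* Main.v *)
Require Import Defs.
From mathcomp Require Import all_boot all_order all_algebra.
From mathcomp Require Import generic_quotient boolp classical_sets cardinality fsbigop.
From mathcomp Require Import zify ring.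

Set Implicit Arguments.
Unset Strict Implicit.
Unset Printing Implicit Defensive.

Import Order.TTheory GRing.Theory Num.Theory.
Local Open Scope ring_scope.

(** The Moebius function of the weak order vanishes outside the longest elements
of finite standard parabolic subgroups: the atoms below [w] are its right
descents, and a set J of descents of [w] has a join below [w], the longest
element w_J of W_J.  Hence (crosscut argument, [moebius_longest])

  chihat M = sum over the sets J with W_J finite of (-1)^|J| q^l(w_J),

which is [chihatE]; J weighs zero when W_J is infinite.  The four identities then
come from sorting the sets J of affine generators by the connected component of
J that contains s_0 (or s_0 and s_1), which ends at the first generator missing
from J.  That component is of type A_k, B_k or D_k and contributes
(-1)^k q^l(w_0) with l(w_0) = k(k+1)/2, k^2 or k(k-1); what lies beyond the
missing generator is an arbitrary subset of a diagram of finite type, and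
summing over it gives the modified characteristic polynomial of that type.

All facts on Coxeter groups are drawn from one tool, the numbers game.
All labels here are 2, 3 or 4, so there is an integral Cartan matrix [a], and W
acts on integer labelings [p] of the generators, [s] acting by
p_t |-> p_t - p_s a_st.  A labeling records the pairings of a weight
with the simple coroots.  If all labels of [p] are positive, then the label at
[s] of [p] moved by [w] is negative exactly when [s] is a right descent of [w]
([descE]); the proof is by reduction to two generators, where it is a finite
check ([dihedral_ascent_pos]).  Consequences:
- W_J has a longest element of length N exactly when N legal moves inside J,
  each at a positive label, turn the labeling 1 negative on J ([play_longest],
  [longest_play]).  This depends only on [a] restricted to J, so the weight of J
  is invariant under embeddings of diagrams and multiplicative over orthogonal
  parts ([weight_imset], [weightU]).
- In the affine types a positive vector c is annihilated by [a]; the sum of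
  c_t p_t is then the same for every position of the game, the labels never
  become all negative, and the full generating set has weight zero
  ([weight_null_vector]).
- In types A, B and D the labels are differences of consecutive coordinates of a
  vector, moves are swaps and sign changes, and the game is sorting by insertion,
  whose moves are easily counted ([reachA], [reachB], [reachD]). *)

(** * The numbers game *)

Section NumbersGame.
Variables (T : Type) (a : T -> T -> int).

Definition fire (s : T) (p : T -> int) : T -> int := fun t => p t - p s * a s t.

Definition play (p : T -> int) (r : seq T) : T -> int :=
  foldl (fun p s => fire s p) p r.

(** A move is legal at a positive label; such moves are the ones that lengthen
the group element. *)
Fixpoint legal (p : T -> int) (r : seq T) : bool :=
  if r is s :: r' then (0 < p s) && legal (fire s p) r' else true.

Lemma play_cat p u v : play p (u ++ v) = play (play p u) v.
Proof. exact: foldl_cat. Qed.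

Lemma play_rcons p u s : play p (rcons u s) = fire s (play p u).
Proof. by rewrite -cats1 play_cat. Qed.

Lemma legal_cat p u v : legal p (u ++ v) = legal p u && legal (play p u) v.
Proof. by elim: u p => //= s u IH p; rewrite IH andbA. Qed.

Lemma play_opp p r : play (fun t => - p t) r = fun t => - play p r t.
Proof.
elim: r p => //= s r IH p; rewrite -IH; congr play.
by apply/funext => t; rewrite /fire; ring.
Qed.

End NumbersGame.

(** * Descents as signs in the numbers game *)
Section CoxeterGame.
Variables (S : finType) (M : coxeter_matrix S) (a : S -> S -> int).

(** Any integral matrix with a_st a_ts = 0, 1, 2 for m(s, t) = 2, 3, 4; for label 4
either of the two asymmetric choices is admitted, and for label 2 both entries
must vanish. *)
Definition cartan_for : Prop := forall s t, a s s = 2 /\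
  (s != t -> (M s t, a s t, a t s) \in
     [:: (2%N, 0, 0); (3%N, -1, -1); (4%N, -1, -2); (4%N, -2, -1)]).

Hypothesis Ca : cartan_for.
Local Notation W := (cox_group M).
Local Notation cls := (cox_class M).
Local Notation len := (@cox_len S M).
Local Notation gen := (cox_gen M).
Implicit Types (p : S -> int) (r : seq S) (w : W) (J : {set S}).

Lemma play_relator p s t : play a p (flatten (nseq (M s t) [:: s; t])) = p.
Proof.
apply/funext => x; case: (eqVneq s t) => [<-|st].
  by rewrite cox_diag /= /fire (Ca s s).1; ring.
have [ss /(_ st)] := Ca s t; have [tt _] := Ca t s.
rewrite !inE => /or4P[] /eqP[-> st' ts'];
  rewrite /= /fire ?(ss, tt, st', ts'); ring.
Qed.

Lemma cox_rel_play u v : cox_rel M u v -> forall p, play a p u = play a p v.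
Proof.
elim=> {u v} [s t|u|u v _ IH|u v w _ IH1 _ IH2|u u' v v' _ IH1 _ IH2] p //.
- exact: play_relator.
- by rewrite IH1.
- by rewrite !play_cat IH1 IH2.
Qed.

(** A word is played from left to right, so this is a right action of W, matched to
right multiplication and right descents. *)
Definition act p w := play a p (repr w).

Lemma act_cls p u : act p (cls u) = play a p u.
Proof. by apply: cox_rel_play; apply/cox_classP; rewrite cox_class_repr. Qed.

Lemma cls_cat u v : cls (u ++ v) = (cls u * cls v)%g.
Proof. exact/esym/cox_mulE. Qed.

Lemma clsP w : exists u, w = cls u.
Proof. by exists (repr w); rewrite cox_class_repr. Qed.

Lemma actM p w x : act p (w * x)%g = act (act p w) x.
Proof.
have [u ->] := clsP w; have [v ->] := clsP x.
by rewrite -cls_cat !act_cls play_cat.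
Qed.

Lemma act1 p : act p 1%g = p. Proof. exact: (act_cls p [::]). Qed.

Lemma act_gen p s : act p (gen s) = fire a s p. Proof. exact: act_cls. Qed.

Lemma cls0 : cls [::] = 1%g. Proof. by []. Qed.

Lemma gen2 s : (gen s * gen s = 1)%g.
Proof. by rewrite -cls_cat; apply/cox_classP; exact: cox_rel_square. Qed.

Lemma mulgen2 w s : (w * gen s * gen s = w)%g.
Proof. by rewrite -mulgA gen2 mulg1. Qed.

Lemma len_cls u : (len (cls u) <= size u)%N.
Proof.
rewrite /cox_len; case: ex_minnP => m _; apply; apply/existsP.
by exists (in_tuple u); rewrite -cox_class_prod.
Qed.

Lemma reducedP w : exists2 u, w = cls u & size u = len w.
Proof.
rewrite /cox_len; case: ex_minnP => m /existsP[u /eqP-> _].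
by exists u; rewrite ?size_tuple // cox_class_prod.
Qed.

Lemma lenM w x : (len (w * x)%g <= len w + len x)%N.
Proof.
have [u -> <-] := reducedP w; have [v -> <-] := reducedP x.
by rewrite -cls_cat -size_cat len_cls.
Qed.

Lemma len1 : len 1%g = 0%N.
Proof. by apply/eqP; rewrite -leqn0; exact: (len_cls [::]). Qed.

Lemma len_mul_gen w s : (len (w * gen s)%g <= (len w).+1)%N.
Proof.
by rewrite -addn1; apply: leq_trans (lenM _ _) _; rewrite leq_add2l (len_cls [:: s]).
Qed.

Lemma len_gen_mul w s : (len w <= (len (w * gen s)%g).+1)%N.
Proof. by rewrite -{1}(mulgen2 w s) len_mul_gen. Qed.

(** The right descents of w are the atoms below it in the left weak order. *)
Definition desc w s : bool := (len (w * gen s)%g < len w)%N.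

Lemma desc_len w s : desc w s -> len w = (len (w * gen s)%g).+1.
Proof. by rewrite /desc; have := len_gen_mul w s; lia. Qed.

Lemma exists_desc w : w <> 1%g -> exists s, desc w s.
Proof.
have [u wE su] := reducedP w; case/lastP: u => [|u s] in wE su *; first by rewrite wE.
move=> _; exists s; rewrite /desc -su wE -cats1 cls_cat mulgen2 cats1 size_rcons.
by rewrite ltnS len_cls.
Qed.

(** Stripping right descents in J one at a time ends at the minimal element [v] of
the coset w W_J, and each letter stripped accounts for one unit of length. *)
Lemma parabolic_factor J w : exists (v : W) r, [/\ w = (v * cls r)%g, len w = (len v + size r)%N,
  all [in J] r & forall s, s \in J -> ~~ desc v s].
Proof.
have [n] := ubnP (len w); elim: n w => // n IH w; rewrite ltnS => lw.
case: (pselect (exists2 s, s \in J & desc w s)) => [[s sJ ds]|nd].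
  have lE := desc_len ds.
  have [|v [r [wE sE rJ vJ]]] := IH (w * gen s)%g; first by lia.
  exists v, (rcons r s); split=> //.
  - by rewrite -cats1 cls_cat mulgA -wE mulgen2.
  - by rewrite lE sE size_rcons addnS.
  - by rewrite all_rcons rJ sJ.
exists w, [::]; split; rewrite ?cls0 ?mulg1 ?addn0 // => s sJ; apply/negP => ds.
by apply: nd; exists s.
Qed.

Lemma cls_rcons r x : cls (rcons r x) = (cls r * gen x)%g.
Proof. by rewrite -cats1 cls_cat. Qed.

Lemma all_rcons2 s t r x : all [in [set s; t]] (rcons r x) -> x = s \/ x = t.
Proof. by rewrite all_rcons !inE => /andP[/orP[]/eqP-> _]; [left|right]. Qed.

(** In a dihedral group, a reduced word that does not shorten when followed by [s]
is empty or an alternating word ... s t ending in t, with fewer than m(s, t)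
letters: at m(s, t) letters the braid relation would produce an equivalent word
ending in s.  As m(s, t) <= 4 this leaves four words, and for each of them the
label at [s] is a combination of [p s] and [p t] with nonnegative coefficients, not
both zero. *)
Lemma dihedral_ascent_pos p s t r : s != t -> all [in [set s; t]] r ->
    (forall r', cls r' = cls r -> (size r <= size r')%N) ->
    (forall r', cls r' = cls (rcons r s) -> (size r <= size r')%N) ->
  0 < p s -> 0 < p t -> 0 < play a p r s.
Proof.
move=> st rJ red nds ps pt.
have [ss /(_ st) Mst] := Ca s t; have [tt _] := Ca t s.
have rel : ((gen s * gen t) ^+ (M s t) = 1)%g.
  transitivity (cls (flatten (nseq (M s t) [:: s; t]))); last first.
    by apply/cox_classP; exact: CoxRelator.
  elim: (M s t : nat) => [//|m IH].
  by rewrite expgS IH /= -[RHS]/(cls ([:: s] ++ [:: t] ++ _)) !cls_cat mulgA.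
have {}red r' : cls r' = cls r -> (size r' < size r)%N -> False.
  by move=> /red; rewrite leqNgt => /negP.
have {}nds r' : cls r' = (cls r * gen s)%g -> (size r' < size r)%N -> False.
  by rewrite -cls_rcons => /nds; rewrite leqNgt => /negP.
have sub r' x : all [in [set s; t]] (rcons r' x) -> all [in [set s; t]] r'.
  by rewrite all_rcons => /andP[].
case/lastP: r => [//|r x] in rJ red nds *.
have [xE|xE] := all_rcons2 rJ; subst x; move/sub: rJ => rJ.
  by case: (nds r); rewrite ?size_rcons // cls_rcons mulgen2.
case/lastP: r => [|r x] in rJ red nds *.
  move: Mst; rewrite /= /fire !inE => /or4P[] /eqP[_ st' ts']; rewrite ?(ss, tt, st', ts'); lia.
have [xE|xE] := all_rcons2 rJ; subst x; move/sub: rJ => rJ; last first.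
  by case: (red r); rewrite ?size_rcons // !cls_rcons mulgen2.
have [m2|m2] := eqVneq (M s t) 2.
  rewrite m2 !expgS expg0 mulg1 !mulgA in rel.
  case: (nds (rcons r t)); rewrite ?size_rcons // !cls_rcons.
  rewrite -!mulgA; congr (_ * _)%g; rewrite !mulgA; apply: (@mulIg _ (gen t)).
  by rewrite rel gen2.
case/lastP: r => [|r x] in rJ red nds *.
  move: Mst; rewrite /= /fire !inE => /or4P[] /eqP[m st' ts'];
    first (by case/eqP: m2); rewrite ?(st', ts', ss, tt); lia.
have [xE|xE] := all_rcons2 rJ; subst x; move/sub: rJ => rJ.
  by case: (red (rcons r t)); rewrite ?size_rcons // !cls_rcons mulgen2.
have [m3|m3] := eqVneq (M s t) 3.
  rewrite m3 !expgS expg0 mulg1 !mulgA in rel.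
  case: (nds (rcons (rcons r s) t)); rewrite ?size_rcons // !cls_rcons.
  rewrite -!mulgA; congr (_ * _)%g; rewrite !mulgA; apply: (@mulIg _ (gen t)).
  by apply: (@mulgI _ (gen s)); rewrite !mulgA rel !mulgen2 gen2.
have m4 : M s t = 4.
  by move: Mst; rewrite !inE => /or4P[] /eqP[m _ _]; move: m2 m3; rewrite m.
case/lastP: r => [|r x] in rJ red nds *.
  move: Mst; rewrite /= /fire !inE => /or4P[] /eqP[m st' ts'];
    rewrite m // in m4; rewrite ?(st', ts', ss, tt); lia.
have [xE|xE] := all_rcons2 rJ; subst x; move/sub: rJ => rJ; last first.
  by case: (red (rcons (rcons r s) t)); rewrite ?size_rcons // !cls_rcons mulgen2.
rewrite m4 !expgS expg0 mulg1 !mulgA in rel.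
case: (nds (rcons (rcons (rcons r t) s) t)); rewrite ?size_rcons // !cls_rcons.
rewrite -!mulgA; congr (_ * _)%g; rewrite !mulgA; apply: (@mulIg _ (gen t * gen s * gen t)%g).
by rewrite !mulgA rel !mulgen2 gen2.
Qed.

(** Induction on the length: if t is a descent of w, factor w = v r with r a word in
s and t.  Neither s nor t is a descent of v, so by induction both labels are
positive after v, and r only mixes these two labels. *)
Lemma nondesc_pos w s p : (forall t, 0 < p t) -> ~~ desc w s -> 0 < act p w s.
Proof.
move=> p0; have [n] := ubnP (len w); elim: n w s => // n IH w s.
rewrite ltnS => lw ds.
case: (pselect (w = 1%g)) => [->|/exists_desc[t dt]]; first by rewrite act1.
have st : s != t by apply: contraNneq ds => ->.
have [v [r [wE sE rJ vJ]]] := parabolic_factor [set s; t] w.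
have lv : (len v < n)%N.
  case: r => [|x r] in wE sE rJ *; last by move: sE lw => /=; lia.
  rewrite cls0 mulg1 in wE; case/negP: (vJ t (set22 s t)).
  by rewrite -wE.
rewrite wE actM act_cls; apply: (dihedral_ascent_pos st rJ).
- move=> r' r'E; have := lenM v (cls r').
  by rewrite r'E -wE sE -r'E; have := len_cls r'; lia.
- move=> r' r'E; have := lenM v (cls r').
  rewrite r'E cls_rcons mulgA -wE -cls_rcons -r'E.
  move=> h; move: ds; rewrite /desc sE -leqNgt => /leq_trans/(_ h).
  by rewrite leq_add2l => /leq_trans; apply; exact: len_cls.
- by apply: IH => //; apply: vJ; rewrite set21.
- by apply: IH => //; apply: vJ; rewrite set22.
Qed.

Lemma desc_neg w s p : (forall t, 0 < p t) -> desc w s -> act p w s < 0.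
Proof.
move=> p0 ds; have ns : ~~ desc (w * gen s)%g s.
  by rewrite /desc mulgen2 -leqNgt ltnW.
have := nondesc_pos p0 ns; rewrite -{2}(mulgen2 w s) (actM p (w * gen s)%g) [in X in _ -> X]act_gen.
by rewrite /fire (Ca s s).1; lia.
Qed.

Lemma descE w s p : (forall t, 0 < p t) -> desc w s = (act p w s < 0).
Proof.
move=> p0; apply/idP/idP; first exact: desc_neg.
by apply: contraTT => /(nondesc_pos p0); lia.
Qed.

(** Equal lengths are impossible: both w and w s would have a positive label at s,
while a move at s reverses that label. *)
Lemma len_ascent w s : ~~ desc w s -> len (w * gen s)%g = (len w).+1.
Proof.
move=> ns; have := len_mul_gen w s; rewrite leq_eqVlt => /predU1P[//|].
rewrite ltnS => le; have ns' : ~~ desc (w * gen s)%g s.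
  by rewrite /desc mulgen2 -leqNgt.
have p0 (t : S) : 0 < (1 : int) by [].
have := nondesc_pos p0 ns; have := nondesc_pos p0 ns'.
by rewrite actM act_gen /fire (Ca s s).1; lia.
Qed.

Lemma nodesc1 w : (forall s, ~~ desc w s) -> w = 1%g.
Proof.
move=> nd; case: (pselect (w = 1%g)) => // /exists_desc[s].
by rewrite (negPf (nd s)).
Qed.

(** Moves inside J read only the labels of J, and change all other labels by amounts
that depend only on these. *)
Lemma play_local J r p q : all [in J] r -> {in J, p =1 q} ->
  forall t, play a p r t - p t = play a q r t - q t.
Proof.
elim: r p q => [|s r IH] p q /=; first by move=> _ _ t; rewrite !subrr.
move=> /andP[sJ rJ] pq t.
have fpq : {in J, fire a s p =1 fire a s q} by move=> x xJ; rewrite /fire !pq.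
have := IH _ _ rJ fpq t.
have : fire a s p t - p t = fire a s q t - q t by rewrite /fire (pq s sJ); lia.
lia.
Qed.

Lemma play_in J r p q : all [in J] r -> {in J, p =1 q} ->
  {in J, play a p r =1 play a q r}.
Proof. by move=> rJ pq t tJ; have := play_local rJ pq t; rewrite pq //; lia. Qed.

(** Makes a labeling that is only positive on J positive everywhere, so that signs of
labels detect descents. *)
Definition dominate J p : S -> int := fun t => if t \in J then p t else 1.

Lemma dominate_in J p : {in J, dominate J p =1 p}.
Proof. by move=> t; rewrite /dominate => ->. Qed.

Lemma dominate_gt0 J p : (forall t, t \in J -> 0 < p t) ->
  forall t, 0 < dominate J p t.
Proof. by move=> p0 t; rewrite /dominate; case: ifP => // /p0. Qed.

(** The word r changes the label at t by an amount that is independent of the initial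
label there, so taking that label large enough keeps it positive. *)
Lemma parabolic_nondesc J r t : all [in J] r -> t \notin J -> ~~ desc (cls r) t.
Proof.
move=> rJ tJ.
(* d is the change of each label, computed once from the labeling 1; off J the new
   labeling p starts above it. *)
pose q (x : S) : int := 1; pose d x := play a q r x - q x.
pose p x : int := if x \in J then 1 else 1 + `|d x|.
have p0 x : 0 < p x by rewrite /p; case: ifP => //; lia.
have pq : {in J, p =1 q} by move=> x; rewrite /p => ->.
rewrite (descE _ _ p0) act_cls -leNgt.
by have := play_local rJ pq t; rewrite {2}/p (negPf tJ) -/(d t); lia.
Qed.

(** The longest element of W_J, characterized by its descents; it exists exactly
when W_J is finite. *)
Definition longest J (u : W) : Prop :=
  (exists2 r, all [in J] r & u = cls r) /\ (forall s, s \in J -> desc u s).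

(** The fundamental domain property of positive labelings: an element of W_J that
moves one J-positive labeling to another has no descent at all, hence is 1. *)
Lemma parabolic_dominant1 J r p : all [in J] r ->
  (forall s, s \in J -> 0 < p s) ->
  (forall s, s \in J -> 0 < play a p r s) -> cls r = 1%g.
Proof.
move=> rJ p0 r0; apply: nodesc1 => s; have [sJ|] := boolP (s \in J); last first.
  exact: parabolic_nondesc rJ.
rewrite (descE _ _ (dominate_gt0 p0)) act_cls -leNgt.
by rewrite (play_in rJ (dominate_in p)) // ltW // r0.
Qed.

(** Both u and u' make the labeling 1 negative on J, so the element u^-1 u' of W_J
moves the opposite of the first result, which is positive on J, to the opposite of
the second one. *)
Lemma longest_uniq J u u' : longest J u -> longest J u' -> u = u'.
Proof.
move=> [[r rJ ->] dr] [[r' rJ' ->] dr'].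
have p0 (t : S) : 0 < (1 : int) by [].
pose p := play a (fun=> 1) r; pose q t := - p t.
have act1u (s : S) v : desc v s -> act (fun=> 1) v s < 0 by rewrite (descE _ _ p0).
have q0 s : s \in J -> 0 < q s by move/dr/act1u; rewrite act_cls /q /p; lia.
have revE v : (cls v * cls (rev v) = 1)%g.
  rewrite -cls_cat; apply/cox_classP.
  by rewrite -{1}[v]revK; exact: cox_rel_revV.
have rrJ : all [in J] (rev r ++ r') by rewrite all_cat all_rev rJ.
apply: (@mulgI _ (cls (rev r))); rewrite -{2}[r]revK revE -cls_cat; apply/esym.
apply: (parabolic_dominant1 rrJ q0) => s /dr' /act1u.
rewrite play_opp /p -play_cat -act_cls catA cls_cat cls_cat revE mul1g; lia.
Qed.

Lemma left_mulE r u : left_mul r u = (cls (rev r) * u)%g.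
Proof.
elim: r u => [|s r IH] u /=; first by rewrite cls0 mul1g.
by rewrite IH rev_cons cls_rcons mulgA.
Qed.

(** Every intermediate length is forced, as each generator changes it by at most 1. *)
Lemma weak_le_mul v u : len (v * u)%g = (len v + len u)%N -> weak_le u (v * u)%g.
Proof.
have [x vE sx] := reducedP v => lE; exists (rev x); first by rewrite left_mulE revK -vE.
move=> j; rewrite size_rev => jx; apply/eqP; rewrite eqn_leq; apply/andP; split.
  rewrite left_mulE; apply: leq_trans (lenM _ _) _; rewrite addnC leq_add2l.
  by apply: leq_trans (len_cls _) _; rewrite size_rev size_take_min geq_minl.
have : (len (v * u)%g <= (size x - j) + len (left_mul (take j (rev x)) u))%N.
  rewrite vE -{1}[x]revK -{1}(cat_take_drop j (rev x)) rev_cat cls_cat -mulgA -(left_mulE (take _ _)).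
  apply: leq_trans (lenM _ _) _; rewrite leq_add2r.
  by apply: leq_trans (len_cls _) _; rewrite size_rev size_drop size_rev.
by rewrite lE -sx; lia.
Qed.

Lemma weak_le_desc u w s : weak_le u w -> desc u s -> desc w s.
Proof.
move=> [r -> /(_ _ (leqnn _))]; rewrite take_size /desc => ->.
rewrite left_mulE -mulgA => ds.
apply: leq_ltn_trans (lenM _ _) _; rewrite addnC -addSn.
by apply: leq_add => //; apply: leq_trans (len_cls _) _; rewrite size_rev.
Qed.

(** The W_J-component u of w works: the minimal coset representative leaves the
labels of J positive, so u and w have the same descents in J. *)
Lemma longest_exists J w : (forall s, s \in J -> desc w s) ->
  exists2 u, longest J u & weak_le u w.
Proof.
move=> dw; have [v [r [wE sE rJ vJ]]] := parabolic_factor J w.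
have lr : len (cls r) = size r.
  apply/eqP; rewrite eqn_leq len_cls -(leq_add2l (len v)) -sE wE; exact: lenM.
exists (cls r); last by rewrite wE; apply: weak_le_mul; rewrite -wE sE lr.
split; first by exists r.
have p0 (t : S) : 0 < (1 : int) by [].
move=> s sJ; have v0 t : t \in J -> 0 < act (fun=> 1) v t.
  by move/vJ; exact: nondesc_pos.
rewrite (descE _ _ (dominate_gt0 v0)) act_cls (play_in rJ (dominate_in _)) //.
by rewrite -act_cls -actM -wE -(descE _ _ p0) dw.
Qed.

(** The longest element of W_J is the join of the atoms in J. *)
Lemma longest_le J u w : longest J u ->
  weak_le u w <-> forall s, s \in J -> desc w s.
Proof.
move=> uL; split=> [le s /(proj2 uL)|/longest_exists[u' /(longest_uniq uL) <-] //].
exact: weak_le_desc.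
Qed.

Lemma play_longest J r p : (forall s, s \in J -> 0 < p s) ->
    all [in J] r -> legal a p r -> (forall s, s \in J -> play a p r s < 0) ->
  longest J (cls r) /\ len (cls r) = size r.
Proof.
move=> p0 rJ lr nr; split.
  split; first by exists r.
  move=> s sJ; rewrite (descE _ _ (dominate_gt0 p0)) act_cls.
  by rewrite (play_in rJ (dominate_in _)) // nr.
elim/last_ind: r rJ lr {nr} => [|r s IH]; first by rewrite cls0 len1.
rewrite all_rcons -cats1 legal_cat /= andbT => /andP[sJ rJ] /andP[lr s0].
rewrite cls_cat len_ascent ?size_cat ?addn1 ?IH //.
rewrite (descE _ _ (dominate_gt0 p0)) act_cls.
by rewrite (play_in rJ (dominate_in _)) // -leNgt ltW.
Qed.

(** A reduced word of u in the letters of J is a legal play from every labeling that is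
positive on J, since each of its letters is an ascent. *)
Lemma longest_play J u : longest J u -> exists r, [/\ all [in J] r, size r = len u &
  forall p, (forall s, s \in J -> 0 < p s) ->
    legal a p r /\ forall s, s \in J -> play a p r s < 0].
Proof.
move=> [[x xJ uE] du]; have [v [r [uE' sE rJ vJ]]] := parabolic_factor J u.
have v1 : v = 1%g.
  have vE : v = cls (x ++ rev r).
    rewrite cls_cat -uE uE' -mulgA -cls_cat -[LHS]mulg1; congr (_ * _)%g.
    apply/esym/cox_classP; rewrite -{1}[r]revK; exact: cox_rel_revV.
  apply: nodesc1 => s; have [/vJ//|sJ] := boolP (s \in J).
  by rewrite vE (@parabolic_nondesc J) // all_cat xJ all_rev.
rewrite {v}v1 mul1g len1 add0n in uE' sE vJ; exists r; split=> // p p0.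
have p'0 := dominate_gt0 p0.
split=> [|s sJ]; last first.
  rewrite -(play_in rJ (dominate_in _)) // -act_cls -uE' -(descE _ _ p'0).
  exact: du.
have red r1 s r2 : r = r1 ++ s :: r2 -> ~~ desc (cls r1) s.
  move=> rE; rewrite /desc -leqNgt; move: sE.
  rewrite uE' rE -cat_rcons cls_cat cls_rcons size_cat size_rcons.
  have := lenM (cls r1 * gen s)%g (cls r2); have := len_cls r2.
  by have := len_cls r1; move=> h1 h2 h3 h4; rewrite h4 in h3; lia.
have {red} : forall r1 r2, r = r1 ++ r2 -> legal a (play a p r1) r2.
  move=> r1 r2; elim: r2 r1 => //= s r2 IH r1 rE.
  have r1J : all [in J] r1 by move: rJ; rewrite rE all_cat => /andP[].
  have sJ : s \in J by move: rJ; rewrite rE all_cat /= => /and3P[].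
  rewrite -play_rcons (IH (rcons r1 s)) ?cat_rcons // andbT.
  rewrite -(play_in r1J (dominate_in p) sJ) -act_cls.
  by apply: nondesc_pos p'0 _; apply: red rE.
by move=> /(_ [::] r) ->.
Qed.

End CoxeterGame.

(** * The Moebius function of the weak order *)
Section ModifiedCharPoly.
Variables (S : finType) (M : coxeter_matrix S) (a : S -> S -> int).
Hypothesis Ca : cartan_for M a.
Local Notation W := (cox_group M).
Local Notation len := (@cox_len S M).
Implicit Types (w u : W) (J : {set S}).

Lemma fsbig_longest (R : nmodType) J u (A : set W) (g : W -> R) :
  longest J u -> A u -> \sum_(t \in A) g t *+ `[< longest J t >] = g u.
Proof.
move=> uL Au; rewrite -(fsbig_widen [set u]%classic).
- by rewrite fsbig_set1 asboolT.
- by move=> _ ->.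
- move=> t [_ tu] /=; rewrite asboolF // => /(longest_uniq Ca uL) ut.
  by apply: tu => /=.
Qed.

Lemma fsbig_exchange (R : nmodType) (A : set W) (F : W -> {set S} -> R) :
  finite_set A ->
  \sum_(t \in A) \sum_J F t J = \sum_J \sum_(t \in A) F t J.
Proof.
move=> fA; rewrite fsbig_finite //= exchange_big /=.
by apply: eq_bigr => J _; rewrite fsbig_finite.
Qed.

(** Expand the product over s of (-[s in D] + 1), which has a zero factor as soon as
D has an element. *)
Lemma altsum_subsets (D : {set S}) :
  \sum_(J : {set S}) ((-1) ^+ #|J| : int) *+ (J \subset D) = (D == finset.set0)%:R.
Proof.
transitivity (\prod_(s : S) ((if s \in D then -1 else 0) + 1) : int).
  rewrite bigA_distr; apply: eq_bigr => J _.
  have [JD|/subsetPn[s sJ sD]] := boolP (J \subset D); last first.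
    by rewrite mulr0n (bigD1 s) //= sJ (negPf sD) mul0r.
  rewrite mulr1n -prodr_const big_mkcond /=.
  apply: eq_bigr => s _; case: ifP => // sJ.
  by rewrite (fintype.subsetP JD).
have [->|/set0Pn[s sD]] := eqVneq D finset.set0; last first.
  by rewrite (bigD1 s) //= sD addNr mul0r.
by apply: big1 => s _; rewrite finset.in_set0 add0r.
Qed.

Lemma weak_le1 w : weak_le 1%g w.
Proof. by have := @weak_le_mul _ M w 1%g; rewrite mulg1 len1 addn0; apply. Qed.

Lemma weak_interval_finite w : finite_set [set t : W | weak_le 1%g t /\ weak_le t w]%classic.
Proof.
by apply: sub_finite_set (finite_cox_len M (len w)) => t [_]; exact: weak_le_len.
Qed.

Definition longest_sum w : int :=
  \sum_(J : {set S}) (-1) ^+ #|J| *+ `[< longest J w >].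

(** The sets J whose longest element lies below w are the subsets of its descent set,
and their signs cancel unless w has no descents. *)
Lemma longest_sum_interval w :
  \sum_(t \in [set t | weak_le 1%g t /\ weak_le t w]%classic) longest_sum t
    = (1%g == w)%:R.
Proof.
rewrite fsbig_exchange; last exact: weak_interval_finite.
transitivity (\sum_(J : {set S})
    ((-1) ^+ #|J| : int) *+ (J \subset [set s | desc w s])).
  apply: eq_bigr => J _; have [JD|JD] := boolP (J \subset _).
    have [s sJ|u uL uw] := longest_exists Ca (J := J) (w := w).
      by have := fintype.subsetP JD s sJ; rewrite inE.
    rewrite (fsbig_longest (fun=> (-1) ^+ #|J|) uL) //=.
    by split=> //; exact: weak_le1.
  apply: fsbig1 => t [_ tw]; rewrite asboolF // => /(longest_le Ca w)/iffLR/(_ tw) JD'.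
  by case/negP: JD; apply/fintype.subsetP => s /JD'; rewrite inE.
rewrite altsum_subsets; congr (_ : bool)%:R; apply/eqP/eqP => [D0|<-].
  apply/esym/nodesc1 => s; apply/negP => ds.
  by have := finset.in_set0 s; rewrite -D0 inE ds.
apply/setP => s; rewrite !inE /desc len1; exact: ltn0.
Qed.

(** Both functions satisfy the recursion that defines the Moebius function. *)
Lemma moebius_longest w : moebius (@weak_le S M) 1%g w = longest_sum w.
Proof.
have [n] := ubnP (len w); elim: n w => // n IH w; rewrite ltnS => lw.
have := (@moebiusP S M).1 1%g w (weak_le1 w); rewrite -longest_sum_interval.
have ww : [set t | weak_le 1%g t /\ weak_le t w]%classic w.
  by split; [exact: weak_le1|exact: weak_le_refl].
rewrite (fsbigD1 w) //=; last exact: weak_interval_finite.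
rewrite [RHS](fsbigD1 w) //=; last exact: weak_interval_finite.
rewrite (_ : \sum_(j \in _ ) moebius _ _ _ = 
  \sum_(j \in [set t | weak_le 1%g t /\ weak_le t w]%classic `\ w) longest_sum j)%classic.
  exact: addIr.
apply: eq_fsbigr => t; rewrite inE => -[[_ tw] ne].
by apply: IH; apply: leq_trans (weak_le_ltn tw ne) lw.
Qed.

(** q^l(w_J), or 0 when W_J is infinite. *)
Definition weight J : {poly int} :=
  if `[< exists u : W, longest J u >]
  then 'X^(len (xget 1%g [set u : W | longest J u]%classic)) else 0.

Lemma weightE J u : longest J u -> weight J = 'X^(len u).
Proof.
move=> uL; rewrite /weight asboolT; last by exists u.
rewrite (@xget_subset1 _ _ _ u) // => x y /= xL yL; exact: (longest_uniq Ca xL yL).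
Qed.

Lemma weight0 J : (forall u : W, ~ longest J u) -> weight J = 0.
Proof. by move=> nL; rewrite /weight asboolF // => -[u /nL]. Qed.

Lemma chihatE : chihat M = \sum_(J : {set S}) (-1) ^+ #|J| * weight J.
Proof.
pose D := [set w : W | exists J, longest J w]%classic.
have fD : finite_set D.
  apply: (@sub_finite_set _ _ ((fun J => xget 1%g [set u : W | longest J u]) @` setT)%classic).
    move=> w [J wL]; exists J => //.
    by rewrite (@xget_subset1 _ _ _ w) // => x y /= xL yL; exact: (longest_uniq Ca xL yL).
  exact/finite_image/finite_finset.
rewrite /chihat -(fsbig_widen D) //; last first.
  move=> w [_ nD] /=; rewrite moebius_longest /longest_sum big1 ?mul0r // => J _.
  by rewrite asboolF // => wL; apply: nD; exists J.
transitivity (\sum_(w \in D) \sum_(J : {set S}) ((-1) ^+ #|J| * 'X^(len w) : {poly int}) *+ `[< longest J w >]).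
  apply: eq_fsbigr => w _; rewrite moebius_longest /longest_sum rmorph_sum mulr_suml.
  apply: eq_bigr => J _; rewrite rmorphMn rmorphXn rmorphN1 /=.
  by rewrite mulrnAl.
rewrite fsbig_exchange //; apply: eq_bigr => J _.
case: (pselect (exists u : W, longest J u)) => [[u uL]|nL].
  rewrite (weightE uL) (fsbig_longest (fun w => (-1) ^+ #|J| * 'X^(len w)) uL) //.
  by exists J.
have {}nL u : ~ longest J u by move=> uL; apply: nL; exists u.
by rewrite weight0 // mulr0 fsbig1 // => w _; rewrite asboolF.
Qed.

End ModifiedCharPoly.

(** * Weights of sets of generators *)
Section Wins.
Variables (T : Type) (a : T -> T -> int).

(** Stated for an arbitrary index type, so that the plays in types A, B and D can be
described once on all natural numbers and then carried to finite diagrams. *)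
Definition wins (J : pred T) (N : nat) : Prop :=
  exists r, [/\ all J r, size r = N, legal a (fun=> 1) r
    & forall s, J s -> play a (fun=> 1) r s < 0].

Lemma play_orthogonal (J K : pred T) r p :
    (forall s t, J s -> K t -> a s t = 0) -> all J r ->
  forall t, K t -> play a p r t = p t.
Proof.
move=> JK; elim: r p => //= s r IH p /andP[Js Jr] t Kt.
by rewrite IH // /fire JK // mulr0 subr0.
Qed.

End Wins.

Section Transfer.
Variables (T' T : Type) (a' : T' -> T' -> int) (a : T -> T -> int).
Variables (f : T' -> T) (J' : pred T').
Hypothesis fa : forall x y, J' x -> J' y -> a (f x) (f y) = a' x y.

Lemma play_map r p q : all J' r -> (forall x, J' x -> p (f x) = q x) ->
  legal a p (map f r) = legal a' q r /\
  forall x, J' x -> play a p (map f r) (f x) = play a' q r x.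
Proof.
elim: r p q => //= s r IH p q /andP[Js Jr] pq.
have fpq x : J' x -> fire a (f s) p (f x) = fire a' s q x.
  by move=> Jx; rewrite /fire !pq // fa.
by have [-> IHp] := IH _ _ Jr fpq; rewrite pq.
Qed.

Variable J : pred T.
Hypothesis fJ : forall x, J' x -> J (f x).
Hypothesis Jf : forall y, J y -> exists2 x, J' x & y = f x.

(** Only the matrix entries seen inside J' and J enter
a play inside these sets. *)
Lemma wins_map N : wins a' J' N <-> wins a J N.
Proof.
split=> -[r [rJ sr lr nr]].
  have [lE pE] := @play_map r (fun=> 1) (fun=> 1) rJ (fun _ _ => erefl).
  exists (map f r); split; rewrite ?size_map ?lE //.
    by rewrite all_map; apply: sub_all rJ.
  by move=> _ /Jf[x Jx ->]; rewrite pE // nr.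
have [r' rJ' rE] : exists2 r', all J' r' & r = map f r'.
  elim: r rJ {sr lr nr} => [|y r IH] /=; first by exists [::].
  move=> /andP[/Jf[x Jx ->] /IH[r' rJ' ->]]; exists (x :: r') => //=.
  by rewrite Jx.
have [lE pE] := @play_map r' (fun=> 1) (fun=> 1) rJ' (fun _ _ => erefl).
exists r'; split; rewrite -?lE -?rE // -?sr ?rE ?size_map //.
by move=> x Jx; rewrite -pE // -rE; apply: nr; apply: fJ.
Qed.

End Transfer.

Section Weight.
Variables (S : finType) (M : coxeter_matrix S) (a : S -> S -> int).
Hypothesis Ca : cartan_for M a.
Implicit Types J K : {set S}.

Lemma wins_longest J N : wins a [in J] N ->
  exists2 u : cox_group M, longest J u & cox_len u = N.
Proof.
move=> [r [rJ <- lr nr]]; exists (cox_class M r);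
  by have [] := play_longest Ca (fun s _ => ltr01) rJ lr nr.
Qed.

Lemma longest_wins J (u : cox_group M) : longest J u -> wins a [in J] (cox_len u).
Proof.
move=> /(longest_play Ca)[r [rJ sr]] /(_ (fun=> 1) (fun _ _ => ltr01)) [lr nr].
by exists r.
Qed.

Lemma wins_weight J N : wins a [in J] N -> weight M J = 'X^N.
Proof. by move=> /wins_longest[u uL <-]; exact: (weightE Ca uL). Qed.

Lemma weight_nowin J : (forall N, ~ wins a [in J] N) -> weight M J = 0.
Proof. by move=> nw; apply: weight0 => u /longest_wins/nw. Qed.

Lemma longest_sub J J' (u : cox_group M) : J' \subset J -> longest J u ->
  exists u' : cox_group M, longest J' u'.
Proof.
move=> /fintype.subsetP J'J [_ du].
by have [s /J'J/du //|u' u'L _] := longest_exists Ca (J := J') (w := u); exists u'.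
Qed.

(** Playing in J does not disturb the labels of K, so the two plays can be made one
after the other. *)
Lemma weightU J K : (forall s t, s \in J -> t \in K -> a s t = 0 /\ a t s = 0) ->
  weight M (J :|: K) = weight M J * weight M K.
Proof.
move=> JK.
case: (pselect (exists u : cox_group M, longest J u)) => [[u uL]|nJ]; last first.
  rewrite [weight M J]weight0 ?mul0r => [|u uL]; last by apply: nJ; exists u.
  by apply: weight0 => x /(longest_sub (finset.subsetUl J K)).
case: (pselect (exists v : cox_group M, longest K v)) => [[v vL]|nK]; last first.
  rewrite [weight M K]weight0 ?mulr0 => [|v vL]; last by apply: nK; exists v.
  by apply: weight0 => x /(longest_sub (finset.subsetUr J K)).
rewrite (weightE Ca uL) (weightE Ca vL) -exprD.
have [r [rJ rs /(_ (fun=> 1) (fun _ _ => ltr01)) [lr nr]]] := longest_play Ca uL.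
have r1 t : t \in K -> play a (fun=> 1) r t = 1.
  by apply: (play_orthogonal (J := [in J])) rJ t => s t sJ tK; have [] := JK s t.
have [r' [rK rs' /(_ (play a (fun=> 1) r))[|lr' nr']]] := longest_play Ca vL.
  by move=> s sK; rewrite r1.
apply: wins_weight; exists (r ++ r'); split.
- rewrite all_cat; apply/andP; split.
    by apply: sub_all rJ => s; rewrite /= finset.in_setU => ->.
  by apply: sub_all rK => s; rewrite /= finset.in_setU orbC => ->.
- by rewrite size_cat rs rs'.
- by rewrite legal_cat lr.
- move=> s; rewrite /= finset.in_setU play_cat => /orP[sJ|]; last exact: nr'.
  rewrite (play_orthogonal (J := [in K]) (K := [in J])) ?nr // => x y xK yJ.
  by have [] := JK y x.
Qed.

(** The sum of the c_t p_t is invariant under moves.  It starts positive and would be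
negative once all labels are. *)
Lemma weight_null_vector (c : S -> int) (s0 : S) : (forall s, 0 < c s) ->
  (forall s, \sum_t a s t * c t = 0) -> weight M [set: S] = 0.
Proof.
move=> c0 ac; apply: weight_nowin => _ [r [_ _ _ nr]].
have inv p : \sum_t play a p r t * c t = \sum_t p t * c t.
  elim: r p {nr} => //= s r IH p; rewrite IH.
  transitivity (\sum_t p t * c t - p s * \sum_t a s t * c t).
    by rewrite mulr_sumr -sumrB; apply: eq_bigr => t _; rewrite /fire; ring.
  by rewrite ac mulr0 subr0.
have : 0 < \sum_t (1 : int) * c t.
  rewrite (bigD1 s0) //= ltr_wpDr // ?mul1r //.
  by apply: sumr_ge0 => t _; rewrite mul1r ltW.
rewrite -inv ltNge => /negP; apply; apply: sumr_le0 => t _.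
by rewrite nmulr_rle0 ?(ltW (c0 t)) // nr // inE.
Qed.

End Weight.

Section Block.
Variables (S S' : finType) (M : coxeter_matrix S) (M' : coxeter_matrix S').
Variables (a : S -> S -> int) (a' : S' -> S' -> int).
Hypotheses (Ca : cartan_for M a) (Ca' : cartan_for M' a').
Variable f : S' -> S.
Hypothesis fa : forall x y, a (f x) (f y) = a' x y.

Lemma weight_imset (J : {set S'}) : weight M (f @: J) = weight M' J.
Proof.
have H N : wins a' [in J] N <-> wins a [in f @: J] N.
  apply: (wins_map (f := f)) => [x y _ _|x xJ|y /imsetP[x xJ ->]] //.
    by apply: imset_f.
  by exists x.
case: (pselect (exists u : cox_group M', longest J u)) => [[u uL]|nJ].
  rewrite (weightE Ca' uL); apply: (wins_weight Ca); apply/H.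
  exact: (longest_wins Ca' uL).
rewrite [RHS]weight0 => [|u uL]; last by apply: nJ; exists u.
apply: (weight_nowin Ca) => N /H/(wins_longest Ca')[u uL _].
by apply: nJ; exists u.
Qed.

(** Sum over the sets J that contain A and miss B, when the remaining generators form
a copy of another diagram, orthogonal to A: J is A together with an arbitrary
subset of that copy. *)
Lemma sum_block (A B : {set S}) : injective f -> [disjoint A & B] ->
    (forall s, (s \notin A) && (s \notin B) = (s \in codom f)) ->
    (forall s x, s \in A -> a s (f x) = 0 /\ a (f x) s = 0) ->
  \sum_(J : {set S} | (A \subset J) && [disjoint J & B]) (-1) ^+ #|J| * weight M J
    = (-1) ^+ #|A| * weight M A * chihat M'.
Proof.
move=> fI AB cf Af; rewrite (chihatE Ca') mulr_sumr.
have fnA x : f x \notin A by have := cf (f x); rewrite codom_f => /andP[].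
have fnB x : f x \notin B by have := cf (f x); rewrite codom_f => /andP[].
rewrite (reindex_onto (fun J' : {set S'} => A :|: f @: J') (fun J => f @^-1: J)) /=.
  apply: eq_big => [J'|J' _].
    rewrite finset.subsetUl /=; apply/andP; split.
      rewrite -finset.setI_eq0 finset.setIUl finset.setU_eq0 !finset.setI_eq0 AB /=; rewrite disjoint_sym; apply/pred0P => s /=.
      by apply/negP => /andP[sB /imsetP[x _ sE]]; move: (fnB x); rewrite -sE sB.
    apply/eqP/finset.setP => x; rewrite !inE (negPf (fnA x)) /=.
    by apply/imsetP/idP => [[y yJ /fI->]|xJ] //; exists x.
  have AJ : A :&: f @: J' = finset.set0.
    apply/finset.setP => s; rewrite !inE; apply/negP => /andP[sA /imsetP[x _ sE]].
    by move: (fnA x); rewrite -sE sA.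
  rewrite cardsU AJ cards0 subn0 card_imset // exprD (weightU Ca) ?weight_imset.
    by rewrite !mulrA; congr (_ * _); rewrite -!mulrA; congr (_ * _); exact: mulrC.
  by move=> s _ sA /imsetP[x _ ->]; exact: Af.
move=> J /andP[AJ JB]; apply/finset.setP => s; rewrite !inE.
have [sA|sA] := boolP (s \in A); first by rewrite (fintype.subsetP AJ).
apply/imsetP/idP => [[x]|sJ /=]; first by rewrite inE => xJ ->.
have /codomP[x sE] : s \in codom f by rewrite -cf sA (disjointFr JB).
by exists x => //; rewrite inE -sE.
Qed.

End Block.

(** * Cartan matrices of labeled graphs *)

(** On an edge with label 4 the entry -2 goes from the smaller vertex to the larger
one; increasing embeddings of graphs then preserve the matrix. *)
Definition graph_cartan (e3 e4 : rel nat) (i j : nat) : int :=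
  if i == j then 2
  else if e4 i j || e4 j i then (if (i < j)%N then -2 else -1)
  else if e3 i j || e3 j i then -1
  else 0.

Lemma graph_cartanP n e3 e4 :
  cartan_for (graph_matrix n e3 e4) (fun i j : 'I_n => graph_cartan e3 e4 i j).
Proof.
move=> s t; split=> [|st]; first by rewrite /graph_cartan eqxx.
have stN : (s : nat) != t := st.
rewrite /= /graph_label (negPf st) /graph_cartan [t == s :> nat]eq_sym (negPf stN).
rewrite [e4 t s || _]orbC [e3 t s || _]orbC.
case: ifP => // _; last by case: ifP.
by case: ltngtP stN.
Qed.

(** * Winning plays in types A, B and D *)
Section Reach.
Variables (T : Type) (a : T -> T -> int) (J : pred T).

Definition reach (p : T -> int) (N : nat) (q : T -> int) : Prop :=
  exists r, [/\ all J r, size r = N, legal a p r & play a p r = q].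

Lemma reach0 p : reach p 0 p. Proof. by exists [::]. Qed.

Lemma reach_cat p m q n q' : reach p m q -> reach q n q' -> reach p (m + n) q'.
Proof.
move=> [r [rJ <- lr rE]] [r' [rJ' <- lr' rE']]; exists (r ++ r'); split.
- by rewrite all_cat rJ.
- exact: size_cat.
- by rewrite legal_cat lr rE.
- by rewrite play_cat rE.
Qed.

Lemma reach1 p s q : J s -> 0 < p s -> fire a s p = q -> reach p 1 q.
Proof. by move=> sJ ps <-; exists [:: s]; split=> //=; rewrite ?sJ ?ps. Qed.

End Reach.

Lemma sub_reach T (a : T -> T -> int) (J J' : pred T) p N q :
  (forall s, J s -> J' s) -> reach a J p N q -> reach a J' p N q.
Proof. by move=> JJ' [r [rJ ? ? ?]]; exists r; split=> //; apply: sub_all rJ. Qed.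

Definition swap (i : nat) (x : nat -> int) (j : nat) : int :=
  if j == i then x i.+1 else if j == i.+1 then x i else x j.

(** Infinite diagrams containing all A_k, B_k and D_k as the initial segments
{0, ..., k-1}.  The edge with label 4 of B joins 0 and 1, and both 0 and 1 are
attached to 2 in D. *)
Definition cartanA := graph_cartan (fun i j => j == i.+1) no_edge.
Definition cartanB :=
  graph_cartan (fun i j => j == i.+1) (fun i j => (i == 0%N) && (j == 1%N)).
Definition cartanD :=
  graph_cartan (fun i j => (0 < i)%N && (j == i.+1) || (i == 0%N) && (j == 2%N)) no_edge.

(** Labels as pairings of the weight with coordinates x_j with the simple coroots:
e_(j+1) - e_j at vertex j for A; for B and D, e_j - e_(j-1) at vertex j > 0, and
e_0 (B) or e_0 + e_1 (D) at vertex 0. *)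
Definition coordA (x : nat -> int) (j : nat) : int := x j.+1 - x j.
Definition coordB (x : nat -> int) (j : nat) : int :=
  if j is j'.+1 then x j'.+1 - x j' else x 0%N.
Definition coordD (x : nat -> int) (j : nat) : int :=
  if j is j'.+1 then x j'.+1 - x j' else x 0%N + x 1%N.

(* Resolves conditionals on arithmetic conditions, discarding contradictory cases. *)
Ltac splitifs := rewrite /=; repeat (case: ifP => ? /=; try lia); try lia.

Lemma fire_coordA i x : fire cartanA i (coordA x) = coordA (swap i x).
Proof.
apply/funext => j; rewrite /fire /coordA /swap /cartanA /graph_cartan /no_edge.
have [->|ji] := eqVneq j i; first by splitifs.
have [->|ji1] := eqVneq j i.+1; first by splitifs.
have [ij|ij1] := eqVneq i j.+1; first by rewrite ij; splitifs.
by splitifs.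
Qed.

Lemma fire_coordB i x : fire cartanB i.+1 (coordB x) = coordB (swap i x).
Proof.
apply/funext => -[|j]; rewrite /fire /coordB /swap /cartanB /graph_cartan.
  by have [->|i0] := eqVneq i 0%N; splitifs.
have [->|ji] := eqVneq j i; first by splitifs.
have [->|ji1] := eqVneq j i.+1; first by splitifs.
have [ij|ij1] := eqVneq i j.+1; first by rewrite ij; splitifs.
by splitifs.
Qed.

Definition neg0 (x : nat -> int) (j : nat) : int := if j == 0%N then - x 0%N else x j.

Lemma fire_coordB0 x : fire cartanB 0 (coordB x) = coordB (neg0 x).
Proof.
apply/funext => -[|[|j]]; rewrite /fire /coordB /neg0 /cartanB /graph_cartan /=; splitifs.
Qed.

Definition negswap (x : nat -> int) (j : nat) : int :=
  if j == 0%N then - x 1%N else if j == 1%N then - x 0%N else x j.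

Lemma fire_coordD i x : fire cartanD i.+1 (coordD x) = coordD (swap i x).
Proof.
apply/funext => -[|j]; rewrite /fire /coordD /swap /cartanD /graph_cartan /no_edge.
  have [->|i0] := eqVneq i 0%N; first by splitifs.
  by have [->|i1] := eqVneq i 1%N; splitifs.
have [->|ji] := eqVneq j i; first by splitifs.
have [->|ji1] := eqVneq j i.+1; first by splitifs.
have [ij|ij1] := eqVneq i j.+1; first by rewrite ij; splitifs.
by splitifs.
Qed.

Lemma fire_coordD0 x : fire cartanD 0 (coordD x) = coordD (negswap x).
Proof.
apply/funext => -[|[|[|j]]];
  rewrite /fire /coordD /negswap /cartanD /graph_cartan /no_edge /=; splitifs.
Qed.

(** Lets a single coordinate travel through a fixed background sequence b, which is how
the longest element is extended from k to k + 1. *)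
Definition insert (v : int) (i : nat) (b : nat -> int) (j : nat) : int :=
  if (j < i)%N then b j else if j == i then v else b j.-1.

Lemma swap_insertS v i b : swap i (insert v i.+1 b) = insert v i b.
Proof.
apply/funext => j; rewrite /swap /insert; have [->|ji] := eqVneq j i; first by splitifs.
by have [->|ji1] := eqVneq j i.+1; splitifs.
Qed.

Lemma swap_insert v i b : swap i (insert v i b) = insert v i.+1 b.
Proof.
apply/funext => j; rewrite /swap /insert; have [->|ji] := eqVneq j i; first by splitifs.
by have [->|ji1] := eqVneq j i.+1; splitifs.
Qed.

(** Moving the inserted value through adjacent swaps: each swap is a legal move when
it puts a larger value in front of a smaller one.  The shift [sh] accounts for the
vertex that carries the swap of positions i and i + 1. *)
Section Sweep.
Variables (a : nat -> nat -> int) (coord : (nat -> int) -> nat -> int) (sh : nat -> nat).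
Hypothesis fire_coord : forall i x, fire a (sh i) (coord x) = coord (swap i x).
Hypothesis coord_sh : forall i x, coord x (sh i) = x i.+1 - x i.
Variables (J : pred nat) (v : int) (b : nat -> int) (lo : nat).

Lemma sweep_down m : (forall i, (lo <= i < lo + m)%N -> J (sh i) && (b i < v)) ->
  reach a J (coord (insert v (lo + m) b)) m (coord (insert v lo b)).
Proof.
elim: m => [|m IH] H; first by rewrite addn0; exact: reach0.
have /andP[Jm bm] : J (sh (lo + m)%N) && (b (lo + m)%N < v) by apply: H; lia.
rewrite -[X in reach _ _ _ X _]add1n; apply: reach_cat _ (IH _) => [|i li]; last by apply: H; lia.
apply: (reach1 (s := sh (lo + m)%N)) => //.
  by rewrite coord_sh /insert; splitifs.
by rewrite fire_coord addnS swap_insertS.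
Qed.

Lemma sweep_up m : (forall i, (lo <= i < lo + m)%N -> J (sh i) && (v < b i)) ->
  reach a J (coord (insert v lo b)) m (coord (insert v (lo + m) b)).
Proof.
elim: m => [|m IH] H; first by rewrite addn0; exact: reach0.
have /andP[Jm bm] : J (sh (lo + m)%N) && (v < b (lo + m)%N) by apply: H; lia.
rewrite -[X in reach _ _ _ X _]addn1; apply: reach_cat (IH _) _ => [i li|]; first by apply: H; lia.
apply: (reach1 (s := sh (lo + m)%N)) => //.
  by rewrite coord_sh /insert; splitifs.
by rewrite fire_coord addnS swap_insert.
Qed.

End Sweep.

(** Coordinates after the longest element of the initial segment of k vertices has
been played: the first k + 1 coordinates reversed (A), the first k negated (B, D).
The coordinates start at x_j = j for A and D and at x_j = j + 1 for B; in type D the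
coordinate x_0 = 0 is its own opposite, so that negating the first k coordinates is
an even number of sign changes for every k. *)
Definition pathA (k j : nat) : int := if (j <= k)%N then k%:Z - j%:Z else j%:Z.
Definition pathB (k j : nat) : int := if (j < k)%N then - j.+1%:Z else j.+1%:Z.
Definition pathD (k j : nat) : int := if (j < k)%N then - j%:Z else j%:Z.

(** The step from k to k + 1 moves the coordinate k + 1 to the front, in k + 1 moves. *)
Lemma reachA k : reach cartanA [pred i | (i < k)%N]
  (coordA (pathA 0)) 'C(k.+1, 2) (coordA (pathA k)).
Proof.
elim: k => [|k IH]; first exact: reach0.
rewrite binS bin1; apply: reach_cat (sub_reach _ IH) _ => [i /= /ltnW //|].
(* The background: the current coordinates without the value k + 1. *)
pose b j : int := if (j <= k)%N then k%:Z - j%:Z else j.+1%:Z.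
have -> : pathA k = insert k.+1%:Z (0 + k.+1) b.
  by apply/funext => -[|j]; rewrite /pathA /insert /b; splitifs.
have -> : pathA k.+1 = insert k.+1%:Z 0 b.
  by apply/funext => -[|j]; rewrite /pathA /insert /b; splitifs.
apply: (sweep_down (sh := id)) => [i x|//|i]; first exact: fire_coordA.
by move=> /andP[_ ik]; rewrite /= /b ik; splitifs.
Qed.

(** The coordinate k + 1 moves to the front in k swaps, changes its sign, and moves
back in k swaps: 2 k + 1 moves in all, the difference of consecutive squares. *)
Lemma reachB k : reach cartanB [pred i | (i < k)%N]
  (coordB (pathB 0)) (k ^ 2) (coordB (pathB k)).
Proof.
elim: k => [|k IH]; first exact: reach0.
have -> : (k.+1 ^ 2 = k ^ 2 + (k + (1 + k)))%N by lia.
apply: reach_cat (sub_reach _ IH) _ => [i /= /ltnW //|].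
pose b j : int := if (j < k)%N then - j.+1%:Z else j.+2%:Z.
have -> : pathB k = insert k.+1%:Z (0 + k) b.
  by apply/funext => -[|j]; rewrite /pathB /insert /b; splitifs.
have -> : pathB k.+1 = insert (- k.+1%:Z) (0 + k) b.
  by apply/funext => -[|j]; rewrite /pathB /insert /b; splitifs.
apply: reach_cat.
  apply: (sweep_down (sh := S)) => [i x|//|i]; first exact: fire_coordB.
  by move=> /andP[_ ik]; rewrite /= /b ik; splitifs.
apply: reach_cat.
  by apply: (reach1 (s := 0%N)) (erefl _).
rewrite fire_coordB0 (_ : neg0 _ = insert (- k.+1%:Z) 0 b); last first.
  by apply/funext => -[|j]; rewrite /neg0 /insert; splitifs.
apply: (sweep_up (sh := S)) => [i x|//|i]; first exact: fire_coordB.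
by move=> /andP[_ ik]; rewrite /= /b ik; splitifs.
Qed.

(** Indexed by k + 1: for a single vertex the play is empty, as negating x_0 = 0
changes nothing.  From k + 1 to k + 2 vertices, the coordinate k + 1 moves to the front,
in k + 1 swaps that take it past x_0 = 0 as well; vertex 0 then swaps the two front
coordinates and changes their signs; k swaps bring the negative value back.  This
makes 2 k + 2 moves. *)
Lemma reachD k : reach cartanD [pred i | (i < k.+1)%N]
  (coordD (pathD 1)) (k.+1 * k) (coordD (pathD k.+1)).
Proof.
elim: k => [|k IH]; first exact: reach0.
have -> : (k.+2 * k.+1 = k.+1 * k + (k + (1 + (1 + k))))%N by lia.
apply: reach_cat (sub_reach _ IH) _ => [i /= /ltnW //|].
pose b j : int := if (j < k.+1)%N then - j%:Z else j.+1%:Z.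
have -> : pathD k.+1 = insert k.+1%:Z (1 + k) b.
  by apply/funext => -[|j]; rewrite /pathD /insert /b; splitifs.
have -> : pathD k.+2 = insert (- k.+1%:Z) (1 + k) b.
  by apply/funext => -[|j]; rewrite /pathD /insert /b; splitifs.
apply: reach_cat.
  apply: (sweep_down (sh := S)) => [i x|//|i]; first exact: fire_coordD.
  by move=> /andP[_ ik]; rewrite /= /b; splitifs.
apply: reach_cat.
  by apply: (reach1 (s := 1%N)) (erefl _).
rewrite fire_coordD swap_insertS; apply: reach_cat.
  by apply: (reach1 (s := 0%N)) (erefl _).
rewrite fire_coordD0 (_ : negswap _ = insert (- k.+1%:Z) 1 b); last first.
  by apply/funext => -[|[|j]]; rewrite /negswap /insert /b; splitifs.
apply: (sweep_up (sh := S)) => [i x|//|i]; first exact: fire_coordD.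
by move=> /andP[_ ik]; rewrite /= /b; splitifs.
Qed.

Lemma reach_wins (a : nat -> nat -> int) k N p q : reach a [pred i | (i < k)%N] p N q ->
  p = (fun=> 1) -> (forall j, (j < k)%N -> q j < 0) -> wins a [pred i | (i < k)%N] N.
Proof. by move=> [r [rJ sr lr <-]] pE q0; exists r; split; rewrite -?pE. Qed.

Lemma winsA k : wins cartanA [pred i | (i < k)%N] 'C(k.+1, 2).
Proof.
apply: (reach_wins (reachA k)).
  by apply/funext => -[|j]; rewrite /coordA /pathA; splitifs.
by move=> j jk; rewrite /coordA /pathA; splitifs.
Qed.

Lemma winsB k : wins cartanB [pred i | (i < k)%N] (k ^ 2).
Proof.
apply: (reach_wins (reachB k)).
  by apply/funext => -[|j]; rewrite /coordB /pathB; splitifs.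
by move=> [|j] jk; rewrite /coordB /pathB; splitifs.
Qed.

(** Two vertices are needed for the label x_0 + x_1 of vertex 0 to be negative. *)
Lemma winsD k : (2 <= k)%N -> wins cartanD [pred i | (i < k)%N] (k * (k - 1)).
Proof.
case: k => // k k1; rewrite subSS subn0; apply: (reach_wins (reachD k)).
  by apply/funext => -[|j]; rewrite /coordD /pathD; splitifs.
by move=> [|j] jk; rewrite /coordD /pathD; splitifs.
Qed.

(** * Sums over sets of vertices with a prescribed pattern *)
Definition ord_set n (A : pred nat) : {set 'I_n} := [set i : 'I_n | A i].

Definition pattern n (A B : pred nat) (J : {set 'I_n}) : bool :=
  [forall i : 'I_n, (A i ==> (i \in J)) && (B i ==> (i \notin J))].

Lemma patternP n (A B : pred nat) (J : {set 'I_n}) :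
  reflect (forall i : 'I_n, (A i -> i \in J) /\ (B i -> i \notin J)) (pattern A B J).
Proof.
apply: (iffP forallP) => H i; first by have /andP[/implyP ? /implyP ?] := H i.
by have [? ?] := H i; apply/andP; split; apply/implyP.
Qed.

Lemma patternE n (A B : pred nat) (J : {set 'I_n}) :
  pattern A B J = (ord_set n A \subset J) && [disjoint J & ord_set n B].
Proof.
apply/patternP/andP => [H|[/fintype.subsetP AJ JB] i].
  split; first by apply/fintype.subsetP => i; rewrite inE; exact: (H i).1.
  apply/pred0P => i /=; rewrite inE; apply/negP => /andP[iJ /(H i).2].
  by rewrite iJ.
split=> [Ai|Bi]; first by apply: AJ; rewrite inE.
by rewrite (disjointFl JB) // inE.
Qed.

Definition signed_weight n e3 e4 (J : {set 'I_n}) : {poly int} :=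
  (-1) ^+ #|J| * weight (graph_matrix n e3 e4) J.

Lemma chihat_graph n e3 e4 :
  chihat (graph_matrix n e3 e4) = \sum_(J : {set 'I_n}) signed_weight e3 e4 J.
Proof. by rewrite (chihatE (@graph_cartanP n e3 e4)). Qed.

Lemma chihat_graph0 e3 e4 : chihat (graph_matrix 0 e3 e4) = 1.
Proof.
rewrite chihat_graph (big_pred1 finset.set0) => [|J].
  rewrite /signed_weight cards0 mul1r (wins_weight (@graph_cartanP 0 e3 e4) (N := 0)) //.
  by exists [::]; split=> // s; rewrite inE.
by apply/esym/eqP/finset.setP => -[].
Qed.

(** The set A is a copy under f of the initial segment {0, ..., k-1} of a diagram on
which a winning play of N moves is known. *)
Lemma signed_weight_wins n e3 e4 (c : nat -> nat -> int) k N (f : nat -> nat) (A : pred nat) :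
    wins c [pred i | (i < k)%N] N ->
    (forall i j, (i < k)%N -> (j < k)%N -> f i = f j -> i = j) ->
    (forall i, (i < k)%N -> (f i <= n)%N && A (f i)) ->
    (forall s, (s <= n)%N -> A s -> exists2 i, (i < k)%N & s = f i) ->
    (forall i j, (i < k)%N -> (j < k)%N -> graph_cartan e3 e4 (f i) (f j) = c i j) ->
  signed_weight e3 e4 (ord_set n.+1 A) = (-1) ^+ k * 'X^N.
Proof.
move=> wN fI fA Af fc; pose F i : 'I_n.+1 := inord (f i).
have FE i : (i < k)%N -> F i = f i :> nat.
  by move=> /fA /andP[fn _]; rewrite /F inordK.
rewrite /signed_weight (wins_weight (@graph_cartanP _ _ _) (N := N)); last first.
  apply/(wins_map (f := F) (J' := [pred i | (i < k)%N]) (a' := c)) => //.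
  - by move=> i j ik jk; rewrite !FE // fc.
  - by move=> i ik; rewrite /= inE FE //; have /andP[] := fA i ik.
  move=> y /=; rewrite inE => /(Af y (ltn_ord y))[i ik yE]; exists i => //.
  by apply: val_inj; rewrite /= FE.
congr (_ ^+ _ * _); transitivity #|[set F i | i : 'I_k]|; last first.
  rewrite card_imset ?card_ord // => i j /(congr1 (@nat_of_ord _)).
  by rewrite !FE // => /fI ij; apply: val_inj; exact: ij.
apply: eq_card => y; rewrite inE; apply/idP/imsetP => [/(Af y (ltn_ord y))[i ik yE]|[i _ ->]].
  by exists (Ordinal ik) => //; apply: val_inj; rewrite /= FE.
by rewrite FE //; have /andP[] := fA i (ltn_ord i).
Qed.

Lemma sum_pattern n e3 e4 m e3' e4' (g : nat -> nat) (A B : pred nat) :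
    (forall i j, (i < m)%N -> (j < m)%N -> g i = g j -> i = j) ->
    (forall i, (i < m)%N -> [&& (g i < n)%N, ~~ A (g i) & ~~ B (g i)]) ->
    (forall s, A s -> ~~ B s) ->
    (forall s, (s < n)%N -> ~~ A s -> ~~ B s -> exists2 i, (i < m)%N & s = g i) ->
    (forall i j, (i < m)%N -> (j < m)%N ->
       graph_cartan e3 e4 (g i) (g j) = graph_cartan e3' e4' i j) ->
    (forall s i, (s < n)%N -> A s -> (i < m)%N ->
       graph_cartan e3 e4 s (g i) = 0 /\ graph_cartan e3 e4 (g i) s = 0) ->
  \sum_(J : {set 'I_n} | pattern A B J) signed_weight e3 e4 J
    = signed_weight e3 e4 (ord_set n A) * chihat (graph_matrix m e3' e4').
Proof.
move=> gI gn AB ABg gc Ag.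
have gn' (i : 'I_m) : (g i < n)%N by have /and3P[] := gn i (ltn_ord i).
pose G i := Ordinal (gn' i).
rewrite (eq_bigl _ _ (patternE A B)).
apply: (sum_block (@graph_cartanP n e3 e4) (@graph_cartanP m e3' e4') (f := G)).
- by move=> i j; apply: gc.
- by move=> i j /(congr1 (@nat_of_ord _)) /= /gI ij; apply: val_inj; exact: ij.
- by apply/pred0P => s; rewrite /= !inE; apply/negP => /andP[/AB/negP].
- move=> s; rewrite !inE; apply/andP/codomP => [[sA sB]|[i ->]].
    have [i im sE] := ABg s (ltn_ord s) sA sB; exists (Ordinal im).
    exact: val_inj.
  by have /and3P[] := gn i (ltn_ord i).
- by move=> s i; rewrite inE => sA; apply: Ag.
Qed.

(** Double counting: each x contributes once for its only index i with Q i x. *)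
Lemma sum_by_unique (I T : finType) (R : nmodType) (P : pred T) (Q : I -> pred T) (F : T -> R) :
    (forall x, P x -> exists i, forall j, Q j x = (j == i)) ->
  \sum_(x | P x) F x = \sum_i \sum_(x | P x && Q i x) F x.
Proof.
move=> PQ; rewrite (exchange_big_dep P) /= => [|i x _ /andP[]//].
apply: eq_bigr => x Px; have [i iE] := PQ x Px.
by rewrite (big_pred1 i) // => j; rewrite Px iE.
Qed.

(** The predicate on the left determines j as the least vertex outside J. *)
Lemma first_missing n (J : {set 'I_n}) : J != finset.setT ->
  exists k : 'I_n, forall j : 'I_n,
    pattern [pred i | (i < j)%N] [pred i | i == j :> nat] J = (j == k).
Proof.
move=> JT; have [k0 kJ] : exists k, k \notin J.
  by apply/existsP; rewrite -negb_forall; apply: contra JT => /forallP JT;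
    apply/eqP/finset.setP => i; rewrite !inE JT.
case: (@arg_minnP _ k0 [pred i | i \notin J] val kJ) => k /= {}kJ kmin.
exists k => j; apply/patternP/eqP => [H|-> i].
  have [_ /(_ (eqxx _)) jJ] := H j.
  apply/val_inj/eqP; rewrite eqn_leq andbC kmin //= leqNgt.
  by apply/negP => kj; have [/(_ kj)] := H k; rewrite (negPf kJ).
split=> [ik|/eqP/val_inj -> //]; apply: contraLR ik => /kmin.
by rewrite -leqNgt.
Qed.

Lemma last_missing n (J : {set 'I_n}) : J != finset.setT ->
  exists k : 'I_n, forall j : 'I_n,
    pattern [pred i | (j < i)%N] [pred i | i == j :> nat] J = (j == k).
Proof.
move=> JT; have [k0 kJ] : exists k, k \notin J.
  by apply/existsP; rewrite -negb_forall; apply: contra JT => /forallP JT;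
    apply/eqP/finset.setP => i; rewrite !inE JT.
case: (@arg_maxnP _ k0 [pred i | i \notin J] val kJ) => k /= {}kJ kmax.
exists k => j; apply/patternP/eqP => [H|-> i].
  have [_ /(_ (eqxx _)) jJ] := H j.
  apply/val_inj/eqP; rewrite eqn_leq kmax //= leqNgt.
  by apply/negP => kj; have [/(_ kj)] := H k; rewrite (negPf kJ).
split=> [ik|/eqP/val_inj -> //]; apply: contraLR ik => /kmax.
by rewrite -leqNgt.
Qed.

(** The vector c certifies that W is infinite, so only proper subsets contribute, and
each of them has a first missing vertex. *)
Lemma chihat_affine_split n e3 e4 (c : nat -> int) :
    (forall s, 0 < c s) ->
    (forall s, (s <= n)%N -> \sum_(0 <= t < n.+1) graph_cartan e3 e4 s t * c t = 0) ->
  chihat (graph_matrix n.+1 e3 e4) = \sum_(0 <= k < n.+1)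
    \sum_(J : {set 'I_n.+1} | pattern [pred i | (i < k)%N] [pred i | i == k] J)
      signed_weight e3 e4 J.
Proof.
move=> c0 cE; rewrite chihat_graph (bigD1 finset.setT) //=.
rewrite {1}/signed_weight (weight_null_vector (@graph_cartanP _ _ _) (c := fun i => c i) ord0) //.
  rewrite mulr0 add0r big_mkord.
  rewrite (sum_by_unique (Q := fun k : 'I_n.+1 =>
    pattern [pred i | (i < k)%N] [pred i | i == k :> nat])); last first.
    by move=> J /first_missing.
  apply: eq_bigr => k _; apply: eq_bigl => J; rewrite andb_idl // => /patternP/(_ k)[_].
  by rewrite /= eqxx => /(_ isT) kJ; apply: contraNneq kJ => ->; rewrite inE.
by move=> s; rewrite -[RHS](cE s (ltn_ord s)) big_mkord.
Qed.

(** * Null vectors of the affine diagrams *)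

(** A row of a Cartan matrix has few nonzero entries; the list l gives the positions
and values of the nonzero terms. *)
Lemma sparse_sum0 N (F : nat -> int) (l : seq (nat * int)) :
    all (fun p => p.1 < N)%N l ->
    (forall t, (t < N)%N -> F t = \sum_(p <- l) (if t == p.1 then p.2 else 0)) ->
    \sum_(p <- l) p.2 = 0 ->
  \sum_(0 <= t < N) F t = 0.
Proof.
move=> lN FE l0; rewrite -[RHS]l0 big_mkord; under eq_bigr => t _ do rewrite FE //.
rewrite exchange_big /=; apply: eq_big_seq => -[u v] /(allP lN) /= uN.
by rewrite -big_mkcond /= (big_pred1 (Ordinal uN)).
Qed.

Ltac cartan_cases := rewrite /graph_cartan /no_edge /=; splitifs.

Tactic Notation "sparse_row" uconstr(l) := refine (@sparse_sum0 _ _ (l : seq (nat * int)) _ _ _) => [/=||];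
  [by lia
  | let t := fresh "t" in let tn := fresh "tn" in
    intros t tn; rewrite ?big_cons ?big_nil /=;
    repeat (case: (eqVneq t _) => ?; [subst t; repeat (case: eqVneq => ?; try lia)|]);
    cartan_cases
  | by rewrite ?big_cons ?big_nil /=; lia].

Definition affA3 n : rel nat := fun i j => (j == i.+1) || (i == 0%N) && (j == n).
Definition affB3 : rel nat :=
  fun i j => (0 < i)%N && (j == i.+1) || (i == 0%N) && (j == 2%N).
Definition affB4 n : rel nat := fun i j => (i.+1 == n) && (j == n).
Definition affC4 n : rel nat := fun i j => (j == i.+1) && ((i == 0%N) || (j == n)).
Definition affD3 n : rel nat :=
  fun i j => [|| [&& (0 < i)%N, j == i.+1 & (j < n)%N],
                    (i == 0%N) && (j == 2%N) | (i.+2 == n) && (j == n)].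
Definition path3 : rel nat := fun i j => j == i.+1.

(** In this and the next three lemmas the coefficients of the vector are the marks of
the affine diagram attached to the chosen orientation of its edges of label 4. *)
Lemma affC_null n s : (2 <= n)%N -> (s <= n)%N ->
  \sum_(0 <= t < n.+1) graph_cartan path3 (affC4 n) s t * (if t == n then 1 else 2) = 0.
Proof.
move=> n2 sn; rewrite /path3 /affC4.
have [->|s0] := eqVneq s 0%N; first (sparse_row ([:: (0%N, 4); (1%N, -4)])).
have [->|sn'] := eqVneq s n; first (sparse_row ([:: (n, 2); (n.-1, -2)])).
sparse_row ([:: (s, 4); (s.-1, -2); (s.+1, -2)]).
Qed.

Lemma affA_null n s : (2 <= n)%N -> (s <= n)%N ->
  \sum_(0 <= t < n.+1) graph_cartan (affA3 n) no_edge s t * 1 = 0.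
Proof.
move=> n2 sn; rewrite /affA3.
have [->|s0] := eqVneq s 0%N; first (sparse_row ([:: (0%N, 2); (1%N, -1); (n, -1)])).
have [->|sn'] := eqVneq s n; first (sparse_row ([:: (n, 2); (n.-1, -1); (0%N, -1)])).
sparse_row ([:: (s, 2); (s.-1, -1); (s.+1, -1)]).
Qed.

Lemma affB_null n s : (3 <= n)%N -> (s <= n)%N ->
  \sum_(0 <= t < n.+1) graph_cartan affB3 (affB4 n) s t *
    (if (t < 2)%N || (t == n) then 1 else 2) = 0.
Proof.
move=> n2 sn; rewrite /affB3 /affB4.
have [->|s0] := eqVneq s 0%N; first (sparse_row ([:: (0%N, 2); (2%N, -2)])).
have [->|s1] := eqVneq s 1%N; first (sparse_row ([:: (1%N, 2); (2%N, -2)])).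
have [->|s2] := eqVneq s 2%N.
  sparse_row ([:: (0%N, -1); (1%N, -1); (2%N, 4); (3%N, -2)]).
have [->|sn'] := eqVneq s n; first (sparse_row ([:: (n, 2); (n.-1, -2)])).
sparse_row ([:: (s, 4); (s.-1, -2); (s.+1, -2)]).
Qed.

Lemma affD_null n s : (4 <= n)%N -> (s <= n)%N ->
  \sum_(0 <= t < n.+1) graph_cartan (affD3 n) no_edge s t *
    (if (t < 2)%N || (n <= t.+1)%N then 1 else 2) = 0.
Proof.
case: n => [|[|n]] // n2 sn; rewrite /affD3.
have [->|s0] := eqVneq s 0%N; first (sparse_row ([:: (0%N, 2); (2%N, -2)])).
have [->|s1] := eqVneq s 1%N; first (sparse_row ([:: (1%N, 2); (2%N, -2)])).
have [->|sn'] := eqVneq s n.+2; first (sparse_row ([:: (n.+2, 2); (n, -2)])).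
have [->|sn1] := eqVneq s n.+1; first (sparse_row ([:: (n.+1, 2); (n, -2)])).
have [n4|n4] := eqVneq n 2%N.
  have -> : s = 2%N by lia.
  rewrite n4; sparse_row ([:: (0%N, -1); (1%N, -1); (2%N, 4); (3%N, -1); (4%N, -1)]).
have [->|s2] := eqVneq s 2%N.
  sparse_row ([:: (0%N, -1); (1%N, -1); (2%N, 4); (3%N, -2)]).
have [->|sn2] := eqVneq s n.
  sparse_row ([:: (n, 4); (n.-1, -2); (n.+1, -1); (n.+2, -1)]).
sparse_row ([:: (s, 4); (s.-1, -2); (s.+1, -2)]).
Qed.

(** * The four affine identities *)
Definition finB4 n : rel nat := fun i j => (j == i.+1) && (j.+1 == n).
Definition finD3 n : rel nat :=
  fun i j => (j == i.+1) && (j.+1 < n)%N || (i.+3 == n) && (j.+1 == n).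

Lemma chihatA_nat n : chihatA n%:Z = chihat (graph_matrix n path3 no_edge).
Proof. by case: n => [|n] //; rewrite chihat_graph0. Qed.

Lemma chihatB_nat n : chihatB n%:Z = chihat (graph_matrix n path3 (finB4 n)).
Proof. by case: n => [|n] //; rewrite chihat_graph0. Qed.

Lemma chihatD_nat n : (2 <= n)%N ->
  chihatD n%:Z = chihat (graph_matrix n (finD3 n) no_edge).
Proof. by case: n => [|[|n]]. Qed.

Lemma wins0 (c : nat -> nat -> int) : wins c [pred i | (i < 0)%N] 0.
Proof. by exists [::]. Qed.

Lemma signed_weight0 n e3 e4 (A : pred nat) : (forall s, ~~ A s) ->
  signed_weight e3 e4 (ord_set n.+1 A) = 1.
Proof.
move=> A0; rewrite (signed_weight_wins (f := id) (wins0 (graph_cartan e3 e4))) ?mulr1 //.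
by move=> s _; rewrite (negPf (A0 s)).
Qed.

Lemma sum_pattern_split n v (A A' B B' : pred nat) (R : nmodType) (F : {set 'I_n} -> R) :
    (v < n)%N -> (forall i, A' i = A i || (i == v)) -> (forall i, B' i = B i || (i == v)) ->
  \sum_(J | pattern A B J) F J = \sum_(J | pattern A' B J) F J + \sum_(J | pattern A B' J) F J.
Proof.
move=> vn A'E B'E; rewrite (bigID (fun J : {set 'I_n} => Ordinal vn \in J)) /=.
congr (_ + _); apply: eq_bigl => J.
  apply/andP/patternP => [[/patternP H vJ] i|H].
    rewrite A'E; split=> [/orP[/(H i).1 //|/eqP iv]|]; last exact: (H i).2.
    by rewrite (_ : i = Ordinal vn) //; apply: val_inj.
  split; last by apply: (H _).1; rewrite A'E eqxx orbT.
  by apply/patternP => i; split=> [Ai|/(H i).2 //]; apply: (H i).1; rewrite A'E Ai.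
apply/andP/patternP => [[/patternP H vJ] i|H].
  rewrite B'E; split=> [|/orP[/(H i).2 //|/eqP iv]]; first exact: (H i).1.
  by rewrite (_ : i = Ordinal vn) //; apply: val_inj.
split; last by apply: (H _).2; rewrite B'E eqxx orbT.
by apply/patternP => i; split=> [/(H i).1 //|Bi]; apply: (H i).2; rewrite B'E Bi.
Qed.

(** The initial segment before the first missing vertex k has type B_k, with l(w_0) = k^2,
and the n - k vertices after k form B_(n-k). *)
Lemma chihat_affC n : (2 <= n)%N ->
  chihat (cox_affC n) =
    \sum_(0 <= k < n.+1) (-1) ^+ k * 'X^(k ^ 2) * chihatB (n%:Z - k%:Z).
Proof.
move=> n2; pose c s : int := if s == n then 1 else 2.
have c0 s : 0 < c s by rewrite /c; case: ifP.
rewrite (chihat_affine_split c0 (fun s => affC_null n2)).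
apply: eq_big_nat => k /andP[_ kn].
rewrite (sum_pattern (m := (n - k)%N) (e3' := path3) (e4' := finB4 (n - k)%N)
  (g := fun i => (k.+1 + i)%N)) /=.
- rewrite (signed_weight_wins (winsB k) (f := id)) //=.
  + by rewrite -chihatB_nat subzn.
  + by move=> i ik; lia.
  + by move=> s sn sk; exists s.
  + by move=> i j ik jk; rewrite /cartanB /affC4 /path3; cartan_cases.
- by move=> i j _ _; lia.
- by move=> i im; lia.
- by move=> s; lia.
- by move=> s sn sk sk'; exists (s - k.+1)%N; lia.
- by move=> i j im jm; rewrite /finB4 /affC4 /path3; cartan_cases.
- by move=> s i sn sk im; split; rewrite /affC4 /path3; cartan_cases.
Qed.

(** If the first missing vertex is 0, the rest is B_n.  If it is 1, the sets contain 0
and miss 1: all subsets of the copy {0, 2, ..., n} of B_n, less those of its part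
{2, ..., n} of type B_(n-1); this gives the terms k = 0 and k = 1.  From k = 2 on the
initial segment has type D_k. *)
Lemma chihat_affB n : (3 <= n)%N ->
  chihat (cox_affB n) =
    chihatB n%:Z + \sum_(0 <= k < n.+1)
      (-1) ^+ k * 'X^(k * (k - 1)) * chihatB (n%:Z - k%:Z).
Proof.
move=> n3; pose c s : int := if (s < 2)%N || (s == n) then 1 else 2.
have c0 s : 0 < c s by rewrite /c; case: ifP.
rewrite (chihat_affine_split c0 (fun s => affB_null n3)).
(* A and B partition the vertices up to k, and the later ones form B_(n-k). *)
have tail (k : nat) (A B : pred nat) : (k <= n)%N ->
    (forall i, (k < i)%N -> ~~ A i && ~~ B i) ->
    (forall s, (s <= k)%N -> A s = ~~ B s) ->
    (forall s t, (s <= n)%N -> A s -> (k < t)%N -> graph_cartan affB3 (affB4 n) s t = 0 /\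
      graph_cartan affB3 (affB4 n) t s = 0) ->
  \sum_(J : {set 'I_n.+1} | pattern A B J) signed_weight affB3 (affB4 n) J =
    signed_weight affB3 (affB4 n) (ord_set n.+1 A) * chihatB (n%:Z - k%:Z).
  move=> kn kAB AB Ak; rewrite subzn // chihatB_nat.
  apply: (sum_pattern (g := fun i => (k.+1 + i)%N)).
  - by move=> i j _ _; lia.
  - by move=> i im; rewrite kAB; lia.
  - by move=> s; have [sk|/kAB/andP[/negPf->]//] := leqP s k; rewrite AB.
  - by move=> s sn sA sB; exists (s - k.+1)%N; have := AB s; lia.
  - by move=> i j im jm; rewrite /finB4 /affB4 /affB3 /path3; cartan_cases.
  - by move=> s i sn sA im; apply: Ak => //; lia.
have one : \sum_(J : {set 'I_n.+1} | pattern pred0 [pred i | i == 1%N] J)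
    signed_weight affB3 (affB4 n) J = chihatB n%:Z.
  rewrite chihatB_nat.
  rewrite (sum_pattern (m := n) (e3' := path3) (e4' := finB4 n)
    (g := fun i => if i == 0%N then 0%N else i.+1)) /=.
  - by rewrite signed_weight0 ?mul1r.
  - by move=> i j _ _; splitifs.
  - by move=> i im; splitifs.
  - by [].
  - by move=> [|[|s]] // sn _ _; [exists 0%N => //; lia | exists s.+1].
  - by move=> [|i] [|j] im jm; rewrite /finB4 /affB4 /affB3 /path3; cartan_cases.
  - by [].
rewrite [LHS]big_ltn // [X in _ + X = _]big_ltn; last by lia.
rewrite [X in _ = _ + X]big_ltn // [X in _ = _ + (_ + X)]big_ltn; last by lia.
rewrite (tail 0%N) //; try by case.
rewrite signed_weight0 // mul1r subr0.
have : \sum_(J : {set 'I_n.+1} | pattern [pred i | (i < 1)%N] [pred i | i == 1%N] J)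
    signed_weight affB3 (affB4 n) J = chihatB n%:Z - chihatB (n%:Z - 1%:Z).
  apply/eqP; rewrite eq_sym subr_eq -one; apply/eqP.
  rewrite (sum_pattern_split (v := 0) (A' := [pred i | (i < 1)%N]) (B' := [pred i | (i < 2)%N])) //=.
  - congr (_ + _); rewrite (tail 1%N) //=.
    + by rewrite signed_weight0 // mul1r.
    + by lia.
    + by move=> i; lia.
    + by move=> i; lia.
  - by case.
  - by move=> [|[|i]].
move=> ->; rewrite subnn muln0 mul0n !expr0 !mul1r expr1 mulr1 mulN1r -!addrA.
congr (_ + (_ + (_ + _))).
apply: eq_big_nat => k /andP[k2 kn].
rewrite (tail k) //=.
- rewrite (signed_weight_wins (winsD k2) (f := id)) //=.
  + by move=> i ik; lia.
  + by move=> s sn sk; exists s.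
  + by move=> i j ik jk; rewrite /cartanD /affB4 /affB3; cartan_cases.
- by move=> i ki; lia.
- by move=> s sk; lia.
- by move=> s t sn sk kt; split; rewrite /affB4 /affB3; cartan_cases.
Qed.

(** As for the type B, except near the end of the diagram.  When the first missing
vertex is n - 1, vertex n is attached to the initial segment {0, ..., n-2}: without
n the component is D_(n-1), with n it is a second component of type D_n, besides
{0, ..., n-1} whose first missing vertex is n.  This is the extra term. *)
Lemma chihat_affD n : (4 <= n)%N ->
  chihat (cox_affD n) =
    chihatD n%:Z + (-1) ^+ n * 'X^(n * (n - 1))
    + \sum_(0 <= k < n.+1) (-1) ^+ k * 'X^(k * (k - 1)) * chihatD (n%:Z - k%:Z).
Proof.
move=> n4; pose c s : int := if (s < 2)%N || (n <= s.+1)%N then 1 else 2.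
have c0 s : 0 < c s by rewrite /c; case: ifP.
rewrite (chihat_affine_split c0 (fun s => affD_null n4)).
(* A and B partition the vertices up to k, and the later ones form D_(n-k). *)
have tail (k : nat) (A B : pred nat) : (k.+2 <= n)%N ->
    (forall i, (k < i)%N -> ~~ A i && ~~ B i) ->
    (forall s, (s <= k)%N -> A s = ~~ B s) ->
    (forall s t, (s <= n)%N -> A s -> (k < t)%N -> graph_cartan (affD3 n) no_edge s t = 0 /\
      graph_cartan (affD3 n) no_edge t s = 0) ->
  \sum_(J : {set 'I_n.+1} | pattern A B J) signed_weight (affD3 n) no_edge J =
    signed_weight (affD3 n) no_edge (ord_set n.+1 A) * chihatD (n%:Z - k%:Z).
  move=> kn kAB AB Ak; rewrite subzn 1?ltnW 1?ltnW // chihatD_nat; last by lia.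
  apply: (sum_pattern (g := fun i => (k.+1 + i)%N)).
  - by move=> i j _ _; lia.
  - by move=> i im; rewrite kAB; lia.
  - by move=> s; have [sk|/kAB/andP[/negPf->]//] := leqP s k; rewrite AB.
  - by move=> s sn sA sB; exists (s - k.+1)%N; have := AB s; lia.
  - by move=> i j im jm; rewrite /finD3 /affD3; cartan_cases.
  - by move=> s i sn sA im; apply: Ak => //; lia.
have one : \sum_(J : {set 'I_n.+1} | pattern pred0 [pred i | i == 1%N] J)
    signed_weight (affD3 n) no_edge J = chihatD n%:Z.
  rewrite chihatD_nat; last by lia.
  rewrite (sum_pattern (m := n) (e3' := finD3 n) (e4' := no_edge)
    (g := fun i => if i == 0%N then 0%N else i.+1)) /=.
  - by rewrite signed_weight0 ?mul1r.
  - by move=> i j _ _; splitifs.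
  - by move=> i im; splitifs.
  - by [].
  - by move=> [|[|s]] // sn _ _; [exists 0%N => //; lia | exists s.+1].
  - by move=> [|i] [|j] im jm; rewrite /finD3 /affD3; cartan_cases.
  - by [].
have initial (k : nat) : (2 <= k <= n)%N ->
    signed_weight (affD3 n) no_edge (ord_set n.+1 [pred i | (i < k)%N])
      = (-1) ^+ k * 'X^(k * (k - 1)).
  move=> /andP[k2 kn]; apply: (signed_weight_wins (winsD k2) (f := id)) => //=.
  + by move=> i ik; lia.
  + by move=> s sn sk; exists s.
  + by move=> i j ik jk; rewrite /cartanD /affD3; cartan_cases.
have noneleft (A B : pred nat) : (forall s, (s <= n)%N -> A s = ~~ B s) ->
    (forall s, A s -> ~~ B s) ->
  \sum_(J : {set 'I_n.+1} | pattern A B J) signed_weight (affD3 n) no_edge J =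
    signed_weight (affD3 n) no_edge (ord_set n.+1 A).
  move=> AB AB'.
  rewrite (sum_pattern (m := 0) (e3' := no_edge) (e4' := no_edge) (g := id)) //.
    by rewrite chihat_graph0 mulr1.
  by move=> s sn; rewrite AB // negbK => ->.
rewrite [LHS]big_ltn // [X in _ + X = _]big_ltn; last by lia.
rewrite [X in _ = _ + X]big_ltn // [X in _ = _ + (_ + X)]big_ltn; last by lia.
rewrite (tail 0%N) //; try by [lia|case].
rewrite signed_weight0 // mul1r subr0.
have -> : \sum_(J : {set 'I_n.+1} | pattern [pred i | (i < 1)%N] [pred i | i == 1%N] J)
    signed_weight (affD3 n) no_edge J = chihatD n%:Z - chihatD (n%:Z - 1%:Z).
  apply/eqP; rewrite eq_sym subr_eq -one; apply/eqP.
  rewrite (sum_pattern_split (v := 0) (A' := [pred i | (i < 1)%N]) (B' := [pred i | (i < 2)%N])) //=.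
  - congr (_ + _); rewrite (tail 1%N) //=.
    + by rewrite signed_weight0 // mul1r.
    + by lia.
    + by move=> i; lia.
    + by move=> i; lia.
  - by case.
  - by move=> [|[|i]].
rewrite subnn muln0 mul0n !expr0 !mul1r expr1 mulr1 mulN1r.
pose extra k : {poly int} := if k == n.-1 then (-1) ^+ n * 'X^(n * (n - 1)) else 0.
have extraE : \sum_(2 <= k < n.+1) extra k = (-1) ^+ n * 'X^(n * (n - 1)).
  rewrite (bigD1_seq n.-1) ?mem_index_iota ?iota_uniq //=; last by lia.
  by rewrite {1}/extra eqxx big1 ?addr0 // => k /negPf; rewrite /extra => ->.
rewrite -extraE -!addrA; congr (_ + _).
rewrite [RHS]addrCA; congr (_ + _); rewrite [RHS]addrCA; congr (_ + _).
rewrite -big_split /=; apply: eq_big_nat => k /andP[k2 kn].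
have [kn1|kn1] := ltnP k.+1 n.
  rewrite (tail k) //=.
  - by rewrite initial ?k2 // /extra (_ : (k == _) = false) ?add0r //; lia.
  - by move=> i ki; lia.
  - by move=> s sk; lia.
  - by move=> s t sn sk kt; split; rewrite /affD3; cartan_cases.
have -> : chihatD (n%:Z - k%:Z) = 1 by rewrite /chihatD ifT //; lia.
rewrite mulr1 /extra; have [kE|kE] := eqVneq k n.-1; last first.
  have kE' : k = n by lia.
  rewrite noneleft ?initial ?add0r ?kE' //=.
  - by lia.
  - by move=> s; lia.
  - by move=> s; lia.
rewrite (sum_pattern_split (v := n) (A' := [pred i | (i < k)%N || (i == n)])
  (B' := [pred i | (k <= i)%N && (i <= n)%N])) //=; last by move=> i; lia.
congr (_ + _); last first.
  rewrite noneleft ?initial //=.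
  - by lia.
  - by move=> s; lia.
  - by move=> s; lia.
rewrite noneleft //=; [|by move=> s; lia|by move=> s; lia].
have n2 : (2 <= n)%N by lia.
(* The automorphism that exchanges n - 1 and n maps the segment of type D_n here. *)
apply: (signed_weight_wins (winsD n2) (f := fun i => if i == k then n else i)) => /=.
- by move=> i j ik jk; splitifs.
- by move=> i ik; splitifs.
- move=> s sn /orP[sk|/eqP->]; last by exists k; rewrite ?eqxx //; lia.
  by exists s; [lia | splitifs].
- move=> i j ik jk; rewrite /cartanD /affD3.
  by case: (eqVneq i k) => ?; case: (eqVneq j k) => ?; cartan_cases.
Qed.

Lemma triangular_sum (R : nmodType) n (t : nat -> R) :
  \sum_(1 <= b < n.+1) \sum_(b <= k < n.+1) t k = \sum_(1 <= k < n.+1) t k *+ k.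
Proof.
transitivity (\sum_(1 <= b < n.+1) \sum_(1 <= k < n.+1) (if (b <= k)%N then t k else 0)).
  apply: eq_big_nat => b /andP[b1 bn].
  rewrite [RHS](big_cat_nat (n := b)) //=; last by lia.
  rewrite [X in _ = X + _]big_nat_cond [X in _ = X + _]big1 ?add0r => [|k /andP[/andP[_ kb] _]];
    last by rewrite leqNgt kb.
  by apply: eq_big_nat => k /andP[-> _].
rewrite exchange_big_nat; apply: eq_big_nat => k /andP[k1 kn].
rewrite (big_cat_nat (n := k.+1)) //=.
rewrite [X in _ + X = _]big_nat_cond [X in _ + X = _]big1 ?addr0 => [|b /andP[/andP[kb _] _]];
  last by rewrite leqNgt kb.
rewrite (eq_big_nat _ _ (F2 := fun=> t k)) => [|b /andP[_]]; last by rewrite ltnS => ->.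
by rewrite sumr_const_nat subSS subn0.
Qed.

(** On the cycle, a proper set J that contains 0 has a first and a last missing vertex
b <= c, and the component of 0 is the arc from c + 1 through n and 0 to b - 1.  It
has k = b + n - c vertices, and each k from 1 to n arises from the k values
b = 1, ..., k, whence the factor k. *)
Section AffineA.
Variable n : nat.
Hypothesis n2 : (2 <= n)%N.
Local Notation sw := (@signed_weight n.+1 (affA3 n) no_edge).

Definition arc_term (k : nat) : {poly int} :=
  (-1) ^+ k * 'X^'C(k.+1, 2) * chihatA (n%:Z - k%:Z - 1).

(** For b = c the arc is the whole path left by removing one vertex, and the polynomial
of A_(-1) is 1, as is that of the empty diagram. *)
Lemma sum_arc b c : (0 < b <= c)%N -> (c <= n)%N ->
  \sum_(J : {set 'I_n.+1} | pattern [pred i | (i < b)%N || (c < i)%N]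
      [pred i | (i == b) || (i == c)] J) sw J = arc_term (b + n - c).
Proof.
move=> /andP[b0 bc] cn.
rewrite (sum_pattern (m := (c - b.+1)%N) (e3' := path3) (e4' := no_edge)
  (g := fun i => (b.+1 + i)%N)) /=.
- rewrite (signed_weight_wins (winsA (b + n - c))
    (f := fun i => if (i < n - c)%N then (c.+1 + i)%N else (i - (n - c))%N)) /=.
  + congr (_ * _); have [->|bc'] := eqVneq b c.
      have -> : (c - c.+1 = 0)%N by lia.
      by rewrite chihat_graph0 /chihatA ifT //; lia.
    by rewrite -chihatA_nat; congr chihatA; lia.
  + by move=> i j ik jk; splitifs.
  + by move=> i ik; splitifs.
  + move=> s sn /orP[sb|cs].
      by exists (s + (n - c))%N; [lia | splitifs].
    by exists (s - c.+1)%N; [lia | splitifs].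
  + move=> i j ik jk; rewrite /cartanA /affA3.
    by case: (ltnP i (n - c)) => ?; case: (ltnP j (n - c)) => ?; cartan_cases.
- by move=> i j _ _; lia.
- by move=> i im; lia.
- by move=> s; lia.
- by move=> s sn sk sk'; exists (s - b.+1)%N; lia.
- by move=> i j im jm; rewrite /path3 /affA3; cartan_cases.
- by move=> s i sn sk im; split; rewrite /affA3; cartan_cases.
Qed.

Lemma sum_arcs_from b : (0 < b <= n)%N ->
  \sum_(J : {set 'I_n.+1} | pattern [pred i | (i < b)%N] [pred i | i == b] J) sw J
    = \sum_(b <= k < n.+1) arc_term k.
Proof.
move=> /andP[b0 bn].
rewrite (sum_by_unique (Q := fun c : 'I_n.+1 =>
    pattern [pred i | (c < i)%N] [pred i | i == c :> nat])); last first.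
  move=> J /patternP/(_ (Ordinal (bn : (b < n.+1)%N)))[_ /= bJ].
  by apply: last_missing; apply: contraTneq (bJ (eqxx _)) => ->; rewrite inE.
transitivity (\sum_(0 <= c < n.+1) (if (b <= c)%N then arc_term (b + n - c) else 0)).
  rewrite big_mkord; apply: eq_bigr => c _; case: ifP => bc.
    rewrite -sum_arc //; [|by rewrite b0|exact: ltn_ord c].
    apply: eq_bigl => J; apply/andP/patternP => [[/patternP H /patternP H'] i|H] /=.
      have := H i; have := H' i => /= -[h1 h2] [h3 h4].
      by split=> /orP[]; [exact: h3|exact: h1|exact: h4|exact: h2].
    split; apply/patternP => i /=; have /= [h1 h2] := H i.
      by split=> h; [apply: h1|apply: h2]; rewrite h.
    by split=> h; [apply: h1|apply: h2]; rewrite h orbT.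
  apply: big1 => J /andP[/patternP/(_ c)[/= cJ _] /patternP/(_ c)[_ /=]].
  by rewrite eqxx cJ //; [move/(_ isT) | lia].
rewrite (big_cat_nat (n := b)) //=; last by lia.
rewrite big_nat_cond big1 ?add0r => [|k /andP[/andP[_ kb] _]]; last by rewrite leqNgt kb.
rewrite big_nat_rev /=; apply: eq_big_nat => k /andP[bk kn].
by rewrite ifT; [congr arc_term|]; lia.
Qed.

Lemma chihat_affA :
  chihat (cox_affA n) = chihatA n%:Z
    + \sum_(1 <= k < n.+1)
        k%:R * (-1) ^+ k * 'X^'C(k.+1, 2) * chihatA (n%:Z - k%:Z - 1).
Proof.
have c0 (s : nat) : 0 < (1 : int) by [].
rewrite (chihat_affine_split c0 (fun s => affA_null n2)) big_ltn //; congr (_ + _).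
  rewrite (sum_pattern (m := n) (e3' := path3) (e4' := no_edge) (g := S)) /=.
  - by rewrite signed_weight0 // mul1r chihatA_nat.
  - by move=> i j _ _; lia.
  - by move=> i im; lia.
  - by [].
  - by move=> [|s] // sn _ _; exists s.
  - by move=> i j im jm; rewrite /path3 /affA3; cartan_cases.
  - by [].
rewrite (eq_big_nat _ _ (F2 := fun b => \sum_(b <= k < n.+1) arc_term k)); last first.
  by move=> b bn; exact: sum_arcs_from.
rewrite triangular_sum.
by apply: eq_big_nat => k _; rewrite /arc_term -!mulrA mulr_natl.
Qed.

End AffineA.

Theorem theorem7p1 :
  [/\ forall n : nat, (2 <= n)%N ->
        chihat (cox_affA n) =
          chihatA n%:Z
          + \sum_(1 <= k < n.+1)
              k%:R * (-1) ^+ k * 'X^'C(k.+1, 2) * chihatA (n%:Z - k%:Z - 1),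
      forall n : nat, (3 <= n)%N ->
        chihat (cox_affB n) =
          chihatB n%:Z
          + \sum_(0 <= k < n.+1)
              (-1) ^+ k * 'X^(k * (k - 1)) * chihatB (n%:Z - k%:Z),
      forall n : nat, (2 <= n)%N ->
        chihat (cox_affC n) =
          \sum_(0 <= k < n.+1)
              (-1) ^+ k * 'X^(k ^ 2) * chihatB (n%:Z - k%:Z)
    & forall n : nat, (4 <= n)%N ->
        chihat (cox_affD n) =
          chihatD n%:Z + (-1) ^+ n * 'X^(n * (n - 1))
          + \sum_(0 <= k < n.+1)
              (-1) ^+ k * 'X^(k * (k - 1)) * chihatD (n%:Z - k%:Z)].
Proof.
split; [exact: chihat_affA | exact: chihat_affB | exact: chihat_affC | exact: chihat_affD].
Qed.
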